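(* Let $V_4,\Phi,F>0$, $\mu>0$, and put $z=8\mu^2F^2V_4$. Let $\nu\ge0$ be an integer and let $(\xi_n)_n$ be a (finite or countably infinite) family of positive random variables with expectation denoted $\langle\cdot\rangle_\nu$. Suppose there is a nonzero constant $c$ such that for all real $j$ $$j^{2\nu}\Big\langle\prod_n\Big(1+\frac{j^2}{\xi_n^2}\Big)\Big\rangle_\nu=c\,Z^{\rm eff}_\nu(\mu,j),$$ the expectation on the left being finite, where $$Z^{\rm eff}_\nu(\mu,j)=\int_0^{2\pi}\frac{d\theta}{2\pi}\,e^{-i\nu\theta}\int_{\mathrm{SU}(4)}dU\,\exp\Big[\mu^2F^2V_4\,\mathrm{tr}(\Sigma B\Sigma^\dagger B)+jV_4\Phi\,\mathrm{Re}\,\mathrm{tr}\big(e^{-i\theta/2}\Sigma_d\Sigma\big)\Big],\qquad \Sigma=U\Sigma_dU^T .$$ Then $$\Big\langle\sum_n\frac1{\xi_n^2}\Big\rangle_\nu=\frac{4(V_4\Phi)^2}{2\nu+1}\;\frac{\displaystyle\int_{S^5}d\vec n\;e^{z(n_2^2+n_4^2)}\,n_4^{2\nu+2}}{\displaystyle\int_{S^5}d\vec n\;e^{z(n_2^2+n_4^2)}\,n_4^{2\nu}},$$ and in particular, for $\nu=0$, $$\Big\langle\sum_n\frac1{\xi_n^2}\Big\rangle_0=2(V_4\Phi)^2\left(\frac{z}{e^z-z-1}+1-\frac2z\right).$$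
   Context: $dU$ is normalized Haar measure on $\mathrm{SU}(4)$ (integrating over $\Sigma=U\Sigma_dU^T$ amounts to integrating over the coset $\mathrm{SU}(4)/\mathrm{Sp}(4)$). In $2\times2$ blocks, $B=\mathrm{diag}(\mathbf 1_2,-\mathbf 1_2)$ and $\Sigma_d=\mathrm{diag}(I,-I)$ with $I=\begin{pmatrix}0&-1\\1&0\end{pmatrix}$. $S^5\subset\mathbb R^6$ is the unit sphere with its rotation-invariant measure $d\vec n$, and $n_2,n_4$ are two of the six Cartesian coordinates of $\vec n\in S^5$. In the source, $\xi_n$ are the nonzero singular values of the Dirac operator of massless two-color QCD with $N_f=2$ flavors in volume $V_4$ at small chemical potential $\mu$, $j$ is the diquark source, $F$ and $\Phi$ are low-energy constants, $\langle\cdot\rangle_\nu$ is the average at topological charge $\nu$, and $Z^{\rm eff}_\nu$ is the finite-volume partition function of the low-density effective theory. *)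

(* Defs.v *)
From HB Require Import structures.
From mathcomp Require Export all_boot all_order all_algebra.
From mathcomp Require Export complex.
From mathcomp Require Export all_classical all_reals all_analysis.

Set Implicit Arguments.
Unset Strict Implicit.
Unset Printing Implicit Defensive.

Export Order.TTheory GRing.Theory Num.Theory.
Export numFieldNormedType.Exports.
Global Open Scope classical_set_scope.
Global Open Scope ring_scope.
Global Open Scope complex_scope.
Global Open Scope sesquilinear_scope.

Definition complex_measure_display : measure_display.
Proof. exact: default_measure_display. Qed.

Definition matrix_measure_display : measure_display -> measure_display.
Proof. exact. Qed.

HB.instance Definition _ (R : realType) := isPointed.Build R[i] 0.

(* Generated by the real and imaginary parts, this is the Borel sigma-algebra
   of the plane. *)
Section measurable_complex.
Variable R : realType.

Let sigmaC : set (set R[i]) :=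
  g_sigma_preimageU (@complex.Re R) (@complex.Im R).

Let sigmaC_set0 : sigmaC set0.
Proof. exact: sigma_algebra0. Qed.

Let sigmaC_setC A : sigmaC A -> sigmaC (~` A).
Proof. exact: sigma_algebraC. Qed.

Let sigmaC_bigcup (F : _^nat) :
  (forall i, sigmaC (F i)) -> sigmaC (\bigcup_i (F i)).
Proof. exact: sigma_algebra_bigcup. Qed.

HB.instance Definition _ := @isMeasurable.Build complex_measure_display
  R[i] sigmaC sigmaC_set0 sigmaC_setC sigmaC_bigcup.

End measurable_complex.

(* Generated by the entries, as the library does for tuples: for real or
   complex entries this is the Borel sigma-algebra of the space of matrices,
   which is second countable. *)
Section measurable_matrix.
Context {d : measure_display} {T : measurableType d}.
Variables m n : nat.

Let sigmaM : set (set 'M[T]_(m, n)) :=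
  <<s \bigcup_(ij in [set: 'I_m * 'I_n])
        preimage_set_system setT (fun A : 'M[T]_(m, n) => A ij.1 ij.2)
          measurable >>.

Let sigmaM_set0 : sigmaM set0.
Proof. exact: sigma_algebra0. Qed.

Let sigmaM_setC A : sigmaM A -> sigmaM (~` A).
Proof. exact: sigma_algebraC. Qed.

Let sigmaM_bigcup (F : _^nat) :
  (forall i, sigmaM (F i)) -> sigmaM (\bigcup_i (F i)).
Proof. exact: sigma_algebra_bigcup. Qed.

HB.instance Definition _ := @isMeasurable.Build (matrix_measure_display d)
  'M[T]_(m, n) sigmaM sigmaM_set0 sigmaM_setC sigmaM_bigcup.

End measurable_matrix.

Definition cexp {R : realType} (z : R[i]) : R[i] :=
  (expR (complex.Re z))%:C * (cos (complex.Im z) +i* sin (complex.Im z)).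

Definition cintegral {d : measure_display} {T : measurableType d}
    {R : realType} (m : {measure set T -> \bar R}) (D : set T)
    (f : T -> R[i]) : R[i] :=
  (\int[m]_(x in D) complex.Re (f x)) +i* (\int[m]_(x in D) complex.Im (f x)).

Definition SU (R : realType) (n : nat) : set 'M[R[i]]_n :=
  [set U | U \is unitarymx /\ \det U = 1].
Arguments SU : clear implicits.

(* Haar measure as a measure on the ambient space of matrices that is carried
   by the group.  Left invariance together with total mass 1 determines it. *)
Definition normalized_haar_SU {R : realType} {n : nat}
    (h : probability 'M[R[i]]_n R) : Prop :=
  h (SU R n) = 1%E /\
  (forall g : 'M[R[i]]_n, SU R n g ->
   forall A : set 'M[R[i]]_n, measurable A ->
     h ((fun U => g *m U) @^-1` A) = h A).

(* The unit sphere of R^n, of dimension n - 1. *)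
Definition unit_sphere (R : realType) (n : nat) : set 'rV[R]_n :=
  [set x | \sum_(i < n) x 0 i ^+ 2 = 1].
Arguments unit_sphere : clear implicits.

(* A nonzero finite measure carried by the sphere and invariant under SO(n),
   hence (for n >= 2) the surface measure up to a positive factor. *)
Definition sphere_measure {R : realType} {n : nat}
    (s : {finite_measure set 'rV[R]_n -> \bar R}) : Prop :=
  [/\ s (~` unit_sphere R n) = 0%E,
      (0 < s (unit_sphere R n))%E &
      forall g : 'M[R]_n, g *m g^T = 1%:M -> \det g = 1 ->
      forall A : set 'rV[R]_n, measurable A ->
        s ((fun x => x *m g) @^-1` A) = s A].

Section effective_theory.
Variable R : realType.

Definition Bmx : 'M[R[i]]_4 :=
  (block_mx 1%:M 0 0 (- 1%:M) : 'M[R[i]]_(2 + 2)).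

(* The matrix with rows (0, -1) and (1, 0). *)
Definition Imx : 'M[R[i]]_2 :=
  \matrix_(a, b) ((b < a)%N%:R - (a < b)%N%:R).

Definition Sigma_d : 'M[R[i]]_4 :=
  (block_mx Imx 0 0 (- Imx) : 'M[R[i]]_(2 + 2)).

Definition Sigma (U : 'M[R[i]]_4) : 'M[R[i]]_4 := U *m Sigma_d *m U^T.

Definition Zeff (haar : probability 'M[R[i]]_4 R)
    (V4 Phi F mu : R) (nu : nat) (j : R) : R[i] :=
  cintegral lebesgue_measure `[0, 2 * pi] (fun theta : R =>
    (2 * pi)^-1%:C * cexp (- 'i * nu%:R * theta%:C) *
    cintegral haar (SU R 4) (fun U =>
      cexp ((mu ^+ 2 * F ^+ 2 * V4)%:C *
              \tr (Sigma U *m Bmx *m (Sigma U)^t* *m Bmx) +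
            (j * V4 * Phi *
              complex.Re (\tr (cexp (- 'i * (theta / 2)%:C) *:
                                 (Sigma_d *m Sigma U))))%:C))).

End effective_theory.

(* The product of 1 + a k over the k satisfying I, as a limit in [0, +oo];
   for a >= 0 the partial products are nondecreasing. *)
Definition eprod1p {R : realType} (I : pred nat) (a : nat -> R) : \bar R :=
  limn (fun n => (\prod_(0 <= k < n | I k) (1 + a k))%:E).

(* Main.v *)
Require Import Defs.
From mathcomp Require Import ring lra measurable_realfun.

(* For U in SU(4), Sigma is a unitary antisymmetric matrix of Pfaffian -1, so
   its entries Sigma_01, Sigma_02, Sigma_03 determine it and form a point of the
   unit sphere of C^3 = R^6.  The pushforward of Haar measure to S^5 is invariant
   under the coordinate rotations involving the first coordinate.  For a
   measure on the sphere with this invariance, integrating the derivative of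
   monomials along rotations yields recursions that determine all moments in two
   coordinates up to the total mass.  Hence Z^eff is, up to a factor, an integral
   over S^5 for any invariant measure, and expanding it to order j^(2 nu + 2)
   reduces the angular integral to Fourier coefficients of cos^(2m)(theta / 2).
   On the other side, for 0 <= t <= 1 and a_n >= 0,
     1 + t sum a_n <= prod (1 + t a_n) <= 1 + t sum a_n + t^2 prod (1 + a_n),
   so the expectation of the product is 1 + j^2 <sum xi_n^-2> + O(j^4).
   Comparing the two expansions gives the sum rule. *)

(** The obstacle is that the image of Haar measure on the sphere has to be compared with another
    invariant measure, in coordinates that may be any two of the six. Uniqueness of an invariant
    measure is bypassed: only moments of [p = n_2^2 + n_4^2] and of [n_4] enter, and rotations of
    the planes through the [n_4] axis already determine them. Each of these rotations lifts to an
    explicit matrix of SU(4), at half the angle. The constants arise as follows. The two traces are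
    [8 p - 4] and, after the phase, [4 cos (theta / 2) n_4], so the exponent of Z^eff is [z p - z /
    2 + kappa j cos (theta / 2) n_4] with [kappa = 4 V4 Phi]. Passing from order [2 nu] to order
    [2 nu + 2] in [j] brings [kappa^2 / ((2 nu + 1) (2 nu + 2))] from the exponential series and
    [(2 nu + 2) / 4] from the Fourier coefficients; their product is the prefactor
    [4 (V4 Phi)^2 / (2 nu + 1)]. All expansions carry explicit remainders, so no derivative is ever
    exchanged with an integral. *)

Set Implicit Arguments.
Unset Strict Implicit.
Unset Printing Implicit Defensive.

(** * Bounded measurable functions and first-order expansions *)

Section bounded_measurable.
Context {d : measure_display} {T : measurableType d} {R : realType}.
Variable D : set T.
Implicit Types f g : T -> R.

(** The bound is on [D] alone, since coordinates are unbounded off the sphere; measurability is on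
    the whole space, so that it composes with rotations without tracking domains. *)
Definition bounded_measurable f :=
  measurable_fun [set: T] f /\ exists K, forall x, D x -> `|f x| <= K.

Lemma bounded_measurable_cst r : bounded_measurable (fun=> r).
Proof. by split; [exact: measurable_cst|exists `|r|]. Qed.

Lemma bounded_measurableD f g : bounded_measurable f -> bounded_measurable g ->
  bounded_measurable (fun x => f x + g x).
Proof.
move=> [mf [K fK]] [mg [L gL]]; split; first exact: measurable_funD.
exists (K + L) => x Dx; apply: (le_trans (ler_normD _ _)).
by rewrite lerD ?fK ?gL.
Qed.

Lemma bounded_measurableM f g : bounded_measurable f -> bounded_measurable g ->
  bounded_measurable (fun x => f x * g x).
Proof.
move=> [mf [K fK]] [mg [L gL]]; split; first exact: measurable_funM.
by exists (K * L) => x Dx; rewrite normrM ler_pM ?fK ?gL.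
Qed.

Lemma bounded_measurableN f : bounded_measurable f ->
  bounded_measurable (fun x => - f x).
Proof.
move=> bf; under [X in bounded_measurable X]eq_fun do rewrite -mulN1r.
by apply: bounded_measurableM => //; exact: bounded_measurable_cst.
Qed.

Lemma bounded_measurableB f g : bounded_measurable f -> bounded_measurable g ->
  bounded_measurable (fun x => f x - g x).
Proof.
by move=> bf bg; apply: bounded_measurableD => //; exact: bounded_measurableN.
Qed.

Lemma bounded_measurableX f n : bounded_measurable f ->
  bounded_measurable (fun x => f x ^+ n).
Proof.
move=> bf; elim: n => [|n IH]; first exact: bounded_measurable_cst.
under [X in bounded_measurable X]eq_fun do rewrite exprS.
exact: bounded_measurableM.
Qed.

Lemma bounded_measurable_sum n (h : nat -> T -> R) :
  (forall k, bounded_measurable (h k)) ->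
  bounded_measurable (fun x => \sum_(0 <= k < n) h k x).
Proof.
move=> bh; elim: n => [|n IH].
  under [X in bounded_measurable X]eq_fun do rewrite big_geq//.
  exact: bounded_measurable_cst.
under [X in bounded_measurable X]eq_fun do rewrite big_nat_recr//=.
exact: bounded_measurableD.
Qed.

Lemma bounded_measurable_expR f : bounded_measurable f ->
  bounded_measurable (fun x => expR (f x)).
Proof.
move=> [mf [K fK]]; split; first exact: measurableT_comp.
exists (expR K) => x Dx; rewrite ger0_norm ?expR_ge0// ler_expR.
exact: le_trans (ler_norm _) (fK _ Dx).
Qed.

Variable m : {measure set T -> \bar R}.
Hypotheses (mD : measurable D) (mDfin : (m D < +oo)%E).

Lemma bounded_measurable_integrable f : bounded_measurable f ->
  m.-integrable D (EFin \o f).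
Proof.
move=> [mf [K fK]]; apply: measurable_bounded_integrable => //.
  exact: measurable_funTS.
exists K; split; first exact: num_real.
by move=> y Ky x Dx; apply: le_trans (fK _ Dx) (ltW Ky).
Qed.

Lemma Rintegral_sum n (h : nat -> T -> R) :
  (forall k, bounded_measurable (h k)) ->
  \int[m]_(x in D) (\sum_(0 <= k < n) h k x) =
  \sum_(0 <= k < n) \int[m]_(x in D) h k x.
Proof.
move=> bh; elim: n => [|n IH].
  rewrite big_geq//; under eq_Rintegral do rewrite big_geq//.
  by rewrite Rintegral_cst// mul0r.
rewrite big_nat_recr//= -IH -RintegralD//; last 2 first.
- exact/bounded_measurable_integrable/bounded_measurable_sum.
- exact: bounded_measurable_integrable.
by apply: eq_Rintegral => x _; rewrite big_nat_recr.
Qed.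

Lemma Rintegral_normr_le f K : bounded_measurable f ->
  (forall x, D x -> `|f x| <= K) ->
  `|\int[m]_(x in D) f x| <= K * fine (m D).
Proof.
move=> bf fK; rewrite -Rintegral_cst//.
apply: le_trans (le_normr_Rintegral _ _) _ => //.
  exact: bounded_measurable_integrable.
apply: le_Rintegral => //.
  have [mf [L fL]] := bf; apply: bounded_measurable_integrable; split.
    exact: measurableT_comp.
  by exists L => x Dx; rewrite normr_id fL.
by apply: bounded_measurable_integrable; exact: bounded_measurable_cst.
Qed.

End bounded_measurable.

Lemma normr_le_linear_eq0 (R : realFieldType) (e K : R) :
  (forall t, 0 < t -> t <= 1 -> `|e| <= K * t) -> e = 0.
Proof.
move=> small; apply/eqP; rewrite -normr_le0; apply/ler_addgt0Pr => r r0.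
rewrite add0r; have K1 : 0 < `|K| + 1 by rewrite ltr_wpDl.
have q0 : 0 < r / (`|K| + 1) by rewrite divr_gt0.
pose t := Num.min 1 (r / (`|K| + 1)).
have t0 : 0 < t by rewrite lt_min ltr01 q0.
apply: le_trans (small _ t0 _) _; first by rewrite ge_min lexx.
have tq : t <= r / (`|K| + 1) by rewrite ge_min lexx orbT.
apply: le_trans (_ : `|K| * (r / (`|K| + 1)) <= _).
  apply: le_trans (_ : `|K| * t <= _); first by rewrite ler_wpM2r ?ler_norm ?ltW.
  by rewrite ler_wpM2l.
by rewrite mulrCA ger_pMr// ler_pdivrMr// mul1r lerDl.
Qed.

(** Uniqueness of the first two Taylor coefficients at 0. One-sided [t] is enough because it is
    applied with [t = j^2]. *)
Lemma normr_le_quadratic_eq0 (R : realFieldType) (u v K : R) :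
  (forall t, 0 < t -> t <= 1 -> `|u + v * t| <= K * t ^+ 2) -> u = 0 /\ v = 0.
Proof.
move=> uvK; have u0 : u = 0.
  apply: (@normr_le_linear_eq0 _ _ (`|K| + `|v|)) => t t0 t1.
  have -> : u = (u + v * t) - v * t by ring.
  apply: le_trans (ler_normB _ _) _; rewrite mulrDl lerD//.
    apply: le_trans (uvK t t0 t1) _.
    apply: le_trans (_ : `|K| * t ^+ 2 <= _).
      by rewrite ler_wpM2r ?sqr_ge0// ler_norm.
    by rewrite ler_wpM2l// expr2 ler_piMr// ltW.
  by rewrite normrM (gtr0_norm t0).
split => //; apply: (@normr_le_linear_eq0 _ _ K) => t t0 t1.
rewrite -(ler_pM2r t0); have := uvK t t0 t1; rewrite u0 add0r normrM (gtr0_norm t0).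
by rewrite -mulrA -expr2.
Qed.

Section first_order_expansions.
Context {d : measure_display} {T : measurableType d} {R : realType}.
Variable D : set T.

(** A Taylor expansion at [t = 0], uniform over [D], with [f1] as derivative. It replaces
    differentiation under the integral sign and is stable under sums, products and powers. *)
Definition first_order (f : R -> T -> R) (f0 f1 : T -> R) :=
  [/\ bounded_measurable D f0, bounded_measurable D f1,
      forall t, bounded_measurable D (f t) &
      exists2 K, 0 <= K & forall t, `|t| <= 1 -> forall x, D x ->
        `|f t x - f0 x - t * f1 x| <= K * t ^+ 2].

Lemma first_order_cst g : bounded_measurable D g ->
  first_order (fun=> g) g (fun=> 0).
Proof.
move=> bg; split=> //; first exact: bounded_measurable_cst.
by exists 0 => // t _ x _; rewrite subrr mulr0 subr0 normr0 mul0r.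
Qed.

Lemma first_orderD f f0 f1 g g0 g1 :
  first_order f f0 f1 -> first_order g g0 g1 ->
  first_order (fun t x => f t x + g t x) (fun x => f0 x + g0 x)
    (fun x => f1 x + g1 x).
Proof.
move=> [bf0 bf1 bf [K K0 fK]] [bg0 bg1 bg [L L0 gL]].
split; [exact: bounded_measurableD..|by move=> t; exact: bounded_measurableD|].
exists (K + L) => [|t t1 x Dx]; first exact: addr_ge0.
rewrite mulrDl; apply: le_trans (lerD (fK _ t1 _ Dx) (gL _ t1 _ Dx)).
apply: le_trans (ler_normD _ _); rewrite le_eqVlt; apply/orP; left.
by apply/eqP; congr (`|_|); ring.
Qed.

Lemma first_orderM f f0 f1 g g0 g1 :
  first_order f f0 f1 -> first_order g g0 g1 ->
  first_order (fun t x => f t x * g t x) (fun x => f0 x * g0 x)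
    (fun x => f1 x * g0 x + f0 x * g1 x).
Proof.
move=> [bf0 bf1 bf [K K0 fK]] [bg0 bg1 bg [L L0 gL]].
split; [exact: bounded_measurableM
  |by apply: bounded_measurableD; exact: bounded_measurableM
  |by move=> t; exact: bounded_measurableM|].
have [_ [A fA]] := bf0; have [_ [B fB]] := bf1.
have [_ [A' gA]] := bg0; have [_ [B' gB]] := bg1.
(* The bounds on [D] may be negative when [D] is empty, hence the absolute values. *)
exists (K * (`|A'| + `|B'| + L) + (`|A| + `|B|) * L + `|B| * `|B'|).
  by rewrite !addr_ge0 ?mulr_ge0 ?addr_ge0.
move=> t t1 x Dx.
have {fA}fA : `|f0 x| <= `|A| by apply: le_trans (fA _ Dx) (ler_norm _).
have {fB}fB : `|f1 x| <= `|B| by apply: le_trans (fB _ Dx) (ler_norm _).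
have {gA}gA : `|g0 x| <= `|A'| by apply: le_trans (gA _ Dx) (ler_norm _).
have {gB}gB : `|g1 x| <= `|B'| by apply: le_trans (gB _ Dx) (ler_norm _).
have t2 : t ^+ 2 <= 1 by rewrite -real_normK ?num_real// expr_le1.
have tB : `|t * f1 x| <= `|B| by rewrite normrM -[leRHS]mul1r ler_pM.
have tB' : `|t * g1 x| <= `|B'| by rewrite normrM -[leRHS]mul1r ler_pM.
have hg := gL _ t1 _ Dx; have hf := fK _ t1 _ Dx.
have gt : `|g t x| <= `|A'| + `|B'| + L.
  have -> : g t x = g0 x + t * g1 x + (g t x - g0 x - t * g1 x) by ring.
  apply: le_trans (ler_normD _ _) _; apply: lerD.
    exact: le_trans (ler_normD _ _) (lerD gA tB').
  by apply: le_trans hg _; rewrite -[leRHS]mulr1 ler_wpM2l.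
have -> : f t x * g t x - f0 x * g0 x - t * (f1 x * g0 x + f0 x * g1 x) =
  (f t x - f0 x - t * f1 x) * g t x +
  (f0 x + t * f1 x) * (g t x - g0 x - t * g1 x) +
  t ^+ 2 * (f1 x * g1 x) by ring.
rewrite [leRHS]mulrDl [X in _ <= X + _]mulrDl.
apply: le_trans (ler_normD _ _) _; apply: lerD; last first.
  by rewrite normrM ger0_norm ?sqr_ge0// mulrC ler_wpM2r ?sqr_ge0// normrM ler_pM.
apply: le_trans (ler_normD _ _) _; apply: lerD.
  by rewrite normrM mulrAC ler_pM.
rewrite normrM -mulrA ler_pM//.
exact: le_trans (ler_normD _ _) (lerD fA tB).
Qed.

Lemma first_orderX n f f0 f1 : first_order f f0 f1 ->
  first_order (fun t x => f t x ^+ n) (fun x => f0 x ^+ n)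
    (fun x => n%:R * f0 x ^+ n.-1 * f1 x).
Proof.
move=> jf; elim: n => [|n IH].
  under [X in first_order _ _ X]eq_fun do rewrite mul0r mul0r.
  by apply: first_order_cst; exact: bounded_measurable_cst.
have := first_orderM jf IH.
congr first_order.
- by apply/funext => t; apply/funext => x; rewrite exprS.
- by apply/funext => x; rewrite exprS.
- apply/funext => x /=; case: n {IH} => [|n] /=.
    by rewrite expr0; ring.
  by rewrite exprS -[in RHS]natr1; ring.
Qed.

Variable m : {measure set T -> \bar R}.
Hypotheses (mD : measurable D) (mDfin : (m D < +oo)%E).

(** The infinitesimal form of invariance. As the integral does not move with [t], [t] times the
    integral of [f1] is minus the integral of the remainder, hence of order [t^2]. *)
Lemma first_order_Rintegral_eq0 f f0 f1 : first_order f f0 f1 ->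
  (forall t, `|t| <= 1 -> \int[m]_(x in D) f t x = \int[m]_(x in D) f0 x) ->
  \int[m]_(x in D) f1 x = 0.
Proof.
move=> [bf0 bf1 bf [K K0 fK]] Ef.
have bi := @bounded_measurable_integrable _ _ _ D m mD mDfin.
set e := \int[m]_(x in D) f1 x; set M := fine (m D).
have bound t : `|t| <= 1 -> `|t * e| <= K * t ^+ 2 * M.
  move=> t1; rewrite -normrN.
  have -> : - (t * e) = \int[m]_(x in D) (f t x - f0 x - t * f1 x).
    rewrite RintegralB//; last 2 first.
    - by apply: bi; exact: bounded_measurableB.
    - apply: bi; apply: bounded_measurableM => //.
      exact: bounded_measurable_cst.
    rewrite RintegralB//; [|exact: bi..].
    by rewrite RintegralZl//; [rewrite Ef// subrr sub0r|exact: bi].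
  apply: Rintegral_normr_le => //; last exact: fK.
  apply: bounded_measurableB; first exact: bounded_measurableB.
  by apply: bounded_measurableM => //; exact: bounded_measurable_cst.
apply: (@normr_le_linear_eq0 _ _ (K * M)) => t t0 t1.
rewrite -(ler_pM2l t0); have := bound t; rewrite normrM gtr0_norm// => /(_ t1) h.
by apply: le_trans h _; rewrite le_eqVlt; apply/orP; left; apply/eqP; ring.
Qed.

End first_order_expansions.

(** * Planar rotations and moments of invariant measures on the sphere *)

Section matrix_measurability.
Context {d : measure_display} {T : measurableType d}.
Variables m n : nat.

Lemma measurable_mxentry i j :
  measurable_fun [set: 'M[T]_(m, n)] (fun A : 'M[T]_(m, n) => A i j).
Proof.
move=> _ B mB; apply: sub_sigma_algebra.
by exists (i, j) => //; exists B.
Qed.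

Lemma measurable_fun_mx {d' : measure_display} {T' : measurableType d'}
    (f : T' -> 'M[T]_(m, n)) :
  (forall i j, measurable_fun [set: T'] (fun w => f w i j)) ->
  measurable_fun [set: T'] f.
Proof.
move=> mf; apply: (measurability (\bigcup_(ij in [set: 'I_m * 'I_n])
  preimage_set_system setT (fun A : 'M[T]_(m, n) => A ij.1 ij.2) measurable)).
  by [].
move=> _ [_ [[i j] _ [B mB <-]] <-] /=.
have := mf i j measurableT B mB.
by congr measurable; rewrite !setTI.
Qed.

End matrix_measurability.

Section planar_rotation.
Variable R : realType.

Definition planar_rotation {n} (i j : 'I_n) (c s : R) : 'M[R]_n :=
  \matrix_(a, b)
    if b == i then c * (a == i)%:R - s * (a == j)%:R
    else if b == j then s * (a == i)%:R + c * (a == j)%:R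
    else (a == b)%:R.

Lemma planar_rotationE n (i j : 'I_n) c s (x : 'rV[R]_n) b :
  (x *m planar_rotation i j c s) 0 b =
    if b == i then c * x 0 i - s * x 0 j
    else if b == j then s * x 0 i + c * x 0 j else x 0 b.
Proof.
have pick k (r : R) : \sum_a x 0 a * (r * (a == k)%:R) = r * x 0 k.
  rewrite (bigD1 k)//= eqxx mulr1 big1 ?addr0 1?mulrC// => a /negPf ->.
  by rewrite !mulr0.
rewrite mxE; case: ifP => bi.
  under eq_bigr do rewrite mxE bi mulrBr.
  by rewrite sumrB !pick.
case: ifP => bj.
  under eq_bigr do rewrite mxE bi bj mulrDr.
  by rewrite big_split/= !pick.
under eq_bigr do rewrite mxE bi bj -[(_ == b)%:R]mul1r.
by rewrite pick mul1r.
Qed.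

Lemma planar_rotation_sphere n (i j : 'I_n) c s : i != j ->
  c ^+ 2 + s ^+ 2 = 1 ->
  (fun x => x *m planar_rotation i j c s) @^-1` unit_sphere R n =
  unit_sphere R n.
Proof.
move=> ij cs; apply/funext => x; rewrite /preimage /unit_sphere /=.
suff -> : \sum_(k < n) (x *m planar_rotation i j c s) 0 k ^+ 2 =
          \sum_(k < n) x 0 k ^+ 2 by [].
have ji : j != i by rewrite eq_sym.
rewrite (bigD1 i)//= (bigD1 j)//= [RHS](bigD1 i)//= [in RHS](bigD1 j)//=.
rewrite !addrA; congr (_ + _); last first.
  apply: eq_bigr => k /andP[/negPf ki /negPf kj].
  by rewrite planar_rotationE ki kj.
rewrite !planar_rotationE !eqxx (negPf ji).
rewrite -[RHS]mul1r -cs; ring.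
Qed.

Lemma unit_sphere_measurable n : measurable (unit_sphere R n).
Proof.
have ms : measurable_fun [set: 'rV[R]_n]
    (fun x : 'rV[R]_n => \sum_(i < n) x 0 i ^+ 2).
  by apply: measurable_sum => i; apply: measurable_funX; exact: measurable_mxentry.
have := ms measurableT [set 1] (measurable_set1 1).
by rewrite setTI.
Qed.

Lemma coord_bounded_measurable n (i : 'I_n) :
  bounded_measurable (unit_sphere R n) (fun x => x 0 i).
Proof.
split; first exact: measurable_mxentry.
exists 1 => x; rewrite /unit_sphere /= => x1.
rewrite -(ler_pXn2r (ltn0Sn 1)) ?nnegrE// expr1n real_normK ?num_real//.
by rewrite -x1 (bigD1 i)//= lerDl sumr_ge0// => k _; exact: sqr_ge0.
Qed.

Lemma mulmxr_measurable n (g : 'M[R]_n) :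
  measurable_fun [set: 'rV[R]_n] (fun x : 'rV[R]_n => x *m g).
Proof.
apply: measurable_fun_mx => i j.
under [X in measurable_fun _ X]eq_fun do rewrite mxE.
apply: measurable_sum => k; apply: measurable_funM; last exact: measurable_cst.
exact: measurable_mxentry.
Qed.

(* The rotation angle is doubled: every such rotation is a square, which makes
   its determinant 1, and it is the angle a one-parameter group of SU(4)
   produces. *)
Definition planar_invariant {n} (i j : 'I_n)
    (s : {measure set 'rV[R]_n -> \bar R}) :=
  forall C S : R, C ^+ 2 + S ^+ 2 = 1 ->
  forall A : set 'rV[R]_n, measurable A ->
    s ((fun x => x *m planar_rotation i j (C ^+ 2 - S ^+ 2) (2 * C * S)) @^-1` A)
    = s A.

Lemma double_angle (C S : R) : C ^+ 2 + S ^+ 2 = 1 ->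
  (C ^+ 2 - S ^+ 2) ^+ 2 + (2 * C * S) ^+ 2 = 1.
Proof.
move=> CS; have -> : (C ^+ 2 - S ^+ 2) ^+ 2 + (2 * C * S) ^+ 2 =
  (C ^+ 2 + S ^+ 2) ^+ 2 by ring.
by rewrite CS expr1n.
Qed.

Lemma planar_invariant_Rintegral n (i j : 'I_n)
    (s : {measure set 'rV[R]_n -> \bar R}) (f : 'rV[R]_n -> R) (C S : R) :
  i != j -> (s (unit_sphere R n) < +oo)%E ->
  planar_invariant i j s -> C ^+ 2 + S ^+ 2 = 1 ->
  bounded_measurable (unit_sphere R n) f ->
  \int[s]_(x in unit_sphere R n)
     f (x *m planar_rotation i j (C ^+ 2 - S ^+ 2) (2 * C * S)) =
  \int[s]_(x in unit_sphere R n) f x.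
Proof.
move=> ij sfin inv CS bf.
set g := planar_rotation _ _ _ _.
have gS : (fun x => x *m g) @^-1` unit_sphere R n = unit_sphere R n.
  apply: planar_rotation_sphere => //.
  exact: double_angle.
have mS : measurable (unit_sphere R n) by exact: unit_sphere_measurable.
have mg := mulmxr_measurable g.
have [mf [K fK]] := bf.
have bfg : bounded_measurable (unit_sphere R n) (f \o (fun x => x *m g)).
  split; first exact: measurableT_comp.
  by exists K => x Sx; apply: fK; rewrite -gS in Sx.
congr fine.
have push : (\int[pushforward s (mulmxr g)]_(x in unit_sphere R n) (f x)%:E =
    \int[s]_(x in unit_sphere R n) (f (x *m g))%:E)%E.
  rewrite (integral_pushforward mg) ?gS//; first exact/measurable_EFinP.
  exact: bounded_measurable_integrable.
by rewrite -push; apply: eq_measure_integral => A mA _; exact: inv.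
Qed.

End planar_rotation.

Ltac bounded_measurable := repeat first
  [ assumption | exact: bounded_measurable_cst
  | exact: coord_bounded_measurable
  | apply: bounded_measurableX | apply: bounded_measurableB | apply: bounded_measurableD
  | apply: bounded_measurableN | apply: bounded_measurableM
  | apply: bounded_measurable_expR ].

Section rotation_expansion.
Context {d : measure_display} {T : measurableType d} {R : realType}.
Variable D : set T.

(** Cosine and sine of twice the angle whose sine is [t]: the rotations of [planar_invariant] with
    [S = t], parametrized algebraically. The definition is meaningful for [|t| <= 1], the range on
    which [first_order] makes its estimate. *)
Let cos2 (t : R) := Num.sqrt (1 - t ^+ 2) ^+ 2 - t ^+ 2.
Let sin2 (t : R) := 2 * Num.sqrt (1 - t ^+ 2) * t.

Lemma cos2_first_order :
  first_order D (fun t (_ : T) => cos2 t) (fun=> 1) (fun=> 0).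
Proof.
split; try (move=> *; exact: bounded_measurable_cst).
exists 2 => // t t1 x _.
have t2 : t ^+ 2 <= 1 by rewrite -real_normK ?num_real// expr_le1.
rewrite mulr0 subr0 /cos2 sqr_sqrtr ?subr_ge0//.
have -> : 1 - t ^+ 2 - t ^+ 2 - 1 = - (2 * t ^+ 2) by ring.
by rewrite normrN ger0_norm// mulr_ge0 ?sqr_ge0.
Qed.

Lemma sin2_first_order :
  first_order D (fun t (_ : T) => sin2 t) (fun=> 0) (fun=> 2).
Proof.
split; try (move=> *; exact: bounded_measurable_cst).
exists 2 => // t t1 x _.
have t2 : t ^+ 2 <= 1 by rewrite -real_normK ?num_real// expr_le1.
set u := Num.sqrt (1 - t ^+ 2).
have u2 : u ^+ 2 = 1 - t ^+ 2 by rewrite sqr_sqrtr ?subr_ge0.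
have u0 : 0 <= u by exact: sqrtr_ge0.
have u1 : u <= 1.
  by rewrite -(ler_pXn2r (ltn0Sn 1)) ?nnegrE// expr1n u2 lerBlDr lerDl sqr_ge0.
have -> : sin2 t - 0 - t * 2 = - (2 * t * (1 - u)) by rewrite /sin2 -/u; ring.
rewrite normrN !normrM (ger0_norm (ler0n _ 2)) -mulrA ler_wpM2l//.
rewrite [`|1 - u|]ger0_norm ?subr_ge0//.
apply: le_trans (_ : 1 * (1 - u) <= _); first by rewrite ler_wpM2r ?subr_ge0.
rewrite mul1r.
have : u ^+ 2 <= u by rewrite expr2 -[leRHS]mulr1 ler_wpM2l.
by rewrite u2; lra.
Qed.

End rotation_expansion.

(** * Recursions for the moments in two coordinates *)

Section sphere_moments.
Context {R : realType}.
Variables (s : {measure set 'rV[R]_6 -> \bar R}) (i4 i2 : 'I_6).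
Hypothesis i24 : i2 != i4.
Hypothesis sfin : (s (unit_sphere R 6) < +oo)%E.
Hypothesis inv : forall i, i != i4 -> planar_invariant i i4 s.

Let S6 := unit_sphere R 6.
Let mS6 : measurable S6. Proof. exact: unit_sphere_measurable. Qed.
Let integrable f : bounded_measurable S6 f -> s.-integrable S6 (EFin \o f).
Proof. exact: bounded_measurable_integrable. Qed.
Local Notation E f := (\int[s]_(x in unit_sphere R 6) f x).
Local Notation y x := (x 0 i4).

Let bm_coord i := @coord_bounded_measurable R 6 i.

(* The integral over the sphere of the derivative of the test function
   [x_i y^a (y^2 + w)^k u] along the rotations of the plane (i, i4). *)
Lemma rotation_derivative_eq0 (i : 'I_6) (w u : 'rV[R]_6 -> R) (a k : nat) :
  i != i4 -> bounded_measurable S6 w -> bounded_measurable S6 u ->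
  (forall C S x, C ^+ 2 + S ^+ 2 = 1 ->
    w (x *m planar_rotation i i4 C S) = w x /\
    u (x *m planar_rotation i i4 C S) = u x) ->
  E (fun x => u x * (
     x 0 i ^+ 2 * (a%:R * y x ^+ a.-1) * (y x ^+ 2 + w x) ^+ k
     + 2 * k%:R * x 0 i ^+ 2 * y x ^+ a.+1 * (y x ^+ 2 + w x) ^+ k.-1
     - y x ^+ a.+1 * (y x ^+ 2 + w x) ^+ k)) = 0.
Proof.
move=> ii4 bw bu wu.
have bx := bm_coord i; have by4 := bm_coord i4.
have jX : first_order S6 (fun t x =>
    (Num.sqrt (1 - t ^+ 2) ^+ 2 - t ^+ 2) * x 0 i +
    (2 * Num.sqrt (1 - t ^+ 2) * t) * (- y x)) _ _ :=
  first_orderD (first_orderM (@cos2_first_order _ _ R S6) (first_order_cst bx))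
   (first_orderM (@sin2_first_order _ _ R S6)
      (first_order_cst (bounded_measurableN by4))).
have jY : first_order S6 (fun t x =>
    (2 * Num.sqrt (1 - t ^+ 2) * t) * x 0 i +
    (Num.sqrt (1 - t ^+ 2) ^+ 2 - t ^+ 2) * y x) _ _ :=
  first_orderD (first_orderM (@sin2_first_order _ _ R S6) (first_order_cst bx))
   (first_orderM (@cos2_first_order _ _ R S6) (first_order_cst by4)).
have jF := first_orderM (first_orderM (first_orderM (first_order_cst bu) jX)
  (first_orderX a jY))
  (first_orderX k (first_orderD (first_orderX 2 jY) (first_order_cst bw))).
set g := (X in Rintegral _ _ X).
have bg : bounded_measurable S6 g by rewrite /g; bounded_measurable.
(* The factor 2 is the speed at [t = 0] of the doubled angle. *)
suff : E (fun x => 2 * g x) = 0.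
  rewrite RintegralZl//; last exact: integrable.
  by move/eqP; rewrite mulf_eq0 pnatr_eq0/= => /eqP.
rewrite -[RHS](first_order_Rintegral_eq0 mS6 sfin jF) => [|t t1].
  apply: eq_Rintegral => x _; rewrite /g.
  rewrite !(mul1r, mul0r, mulr0, addr0, add0r).
  by case: k {jF g bg} => [|k] /=; rewrite ?exprS ?expr0 ?expr1; ring.
have t2 : 0 <= 1 - t ^+ 2.
  by rewrite subr_ge0 -real_normK ?num_real// expr_le1.
have Ct : Num.sqrt (1 - t ^+ 2) ^+ 2 + t ^+ 2 = 1 by rewrite sqr_sqrtr// subrK.
set F := (X in _ = Rintegral _ _ X).
rewrite -[RHS](planar_invariant_Rintegral ii4 sfin (inv ii4) Ct); last first.
  by rewrite /F; bounded_measurable.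
apply: eq_Rintegral => x _; rewrite /F.
have i4i : i4 != i by rewrite eq_sym.
have [-> ->] := wu (Num.sqrt (1 - t ^+ 2) ^+ 2 - t ^+ 2)
  (2 * Num.sqrt (1 - t ^+ 2) * t) x (double_angle Ct).
rewrite !planar_rotationE !eqxx (negPf i4i).
by rewrite !mul1r !mul0r !addr0 !add0r mulrN.
Qed.

Local Notation p x := (x 0 i2 ^+ 2 + x 0 i4 ^+ 2).

Definition sphere_moment m k := E (fun x => p x ^+ m * y x ^+ k).

Let bm_mono m k : bounded_measurable S6 (fun x => p x ^+ m * y x ^+ k).
Proof. by bounded_measurable. Qed.

(** Rotations of the plane [(i2, i4)] fix [p]. Differentiating [x_i2 y^(k+1) p^m] along them and
    replacing [x_i2^2] by [p - y^2] gives the relation. *)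
Lemma sphere_moment_shift m k :
  k.+2%:R * sphere_moment m k.+2 = k.+1%:R * sphere_moment m.+1 k.
Proof.
have i42 : i4 != i2 by rewrite eq_sym.
have := @rotation_derivative_eq0 i2 (fun=> 0) (fun x => p x ^+ m) k.+1 0 i24.
move=> /= /(_ _ _ _) H.
rewrite /sphere_moment -!RintegralZl//; [|exact: integrable..].
apply/eqP; rewrite -subr_eq0 -RintegralB//; last 2 first.
- by apply: integrable; bounded_measurable.
- by apply: integrable; bounded_measurable.
rewrite -oppr_eq0; apply/eqP.
have {}H := H _ _ _.
rewrite -[RHS]H; last 3 first.
- by bounded_measurable.
- by bounded_measurable.
- move=> C S x CS; split => //; rewrite !planar_rotationE !eqxx (negPf i42).
  by congr (_ ^+ _); rewrite -[RHS]mul1r -CS; ring.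
rewrite -mulN1r -RintegralZl//; last first.
  by apply: integrable; bounded_measurable.
apply: eq_Rintegral => x _.
by rewrite !exprS expr0 -[k.+2%:R]natr1 -[k.+1%:R]natr1; ring.
Qed.

(** The half-angle pair [(0, 1)] is the rotation by pi in the plane [(i2, i4)], which fixes [p] and
    negates [y]. *)
Lemma sphere_moment_odd m k : odd k -> sphere_moment m k = 0.
Proof.
move=> ok; have i42 : i4 != i2 by rewrite eq_sym.
have cs : (0 : R) ^+ 2 + 1 ^+ 2 = 1 by rewrite expr0n expr1n add0r.
have := planar_invariant_Rintegral i24 sfin (inv i24) cs (bm_mono m k).
rewrite -/(sphere_moment m k) => H.
suff : sphere_moment m k = - sphere_moment m k by lra.
rewrite -{1}H -[RHS]mulN1r /sphere_moment -RintegralZl//; last exact: integrable.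
apply: eq_Rintegral => x _; rewrite !planar_rotationE !eqxx (negPf i42).
rewrite mulrCA; congr (_ * _); first by congr (_ ^+ _); ring.
rewrite !(mulr0, mul0r, add0r) expr0n expr1n /= sub0r mulN1r.
by rewrite exprNn -signr_odd ok expr1.
Qed.

(** Differentiate [x_i y p^m] along the plane [(i, i4)] for each of the four remaining directions
    [i] and add: on the sphere their squares sum to [1 - p], so only [p] and [y] survive.
    [sphere_moment_shift] then turns [y^2 p^m] into [p^(m+1) / 2]. *)
Lemma sphere_moment_radial m :
  m.+3%:R * sphere_moment m.+1 0 = m.+1%:R * sphere_moment m 0.
Proof.
have i42 : i4 != i2 by rewrite eq_sym.
pose g (i : 'I_6) (x : 'rV[R]_6) := x 0 i ^+ 2 * p x ^+ m
     + 2 * m%:R * x 0 i ^+ 2 * y x ^+ 2 * p x ^+ m.-1 - y x ^+ 2 * p x ^+ m.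
have bg i : bounded_measurable S6 (g i) by rewrite /g; bounded_measurable.
have g0 i : i != i4 -> i != i2 -> E (g i) = 0.
  move=> ii4 ii2.
  rewrite -[RHS](@rotation_derivative_eq0 i (fun x => x 0 i2 ^+ 2) (fun=> 1) 1 m ii4).
  - apply: eq_Rintegral => x _; rewrite /g /= expr0 [y x ^+ 2 + _]addrC; ring.
  - by bounded_measurable.
  - by bounded_measurable.
  - move=> C S x _; split => //; rewrite planar_rotationE.
    by rewrite eq_sym (negPf ii2) (negPf i24).
pose h (i : 'I_6) (x : 'rV[R]_6) := if (i != i4) && (i != i2) then g i x else 0.
have bh i : bounded_measurable S6 (h i).
  rewrite /h; case: ((i != i4) && (i != i2)); first exact: bg.
  exact: bounded_measurable_cst.
have sum_g : E (fun x => \sum_(i < 6) h i x) = 0.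
  pose h' k (x : 'rV[R]_6) := h (inord k) x.
  transitivity (E (fun x => \sum_(0 <= k < 6) h' k x)).
    apply: eq_Rintegral => x _; rewrite big_mkord.
    by apply: eq_bigr => i _; rewrite /h' inord_val.
  rewrite (Rintegral_sum mS6 sfin) => [|k]; last exact: bh.
  rewrite big1// => k _; rewrite /h' /h.
  case: (boolP ((inord k != i4) && (inord k != i2))) => [/andP[k4 k2]|_].
    exact: g0.
  by rewrite Rintegral_cst// mul0r.
have bp : bounded_measurable S6 (fun x => p x ^+ m) by bounded_measurable.
have bp1 : bounded_measurable S6 (fun x => p x ^+ m.+1) by bounded_measurable.
have by2 : bounded_measurable S6 (fun x => p x ^+ m * y x ^+ 2).
  by bounded_measurable.
have bp2 : bounded_measurable S6 (fun x => p x ^+ m.-1 * y x ^+ 2).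
  by bounded_measurable.
have : E (fun x => p x ^+ m - p x ^+ m.+1 +
     (2 * m%:R * (p x ^+ m.-1 * y x ^+ 2) - (2 * m + 4)%:R * (p x ^+ m * y x ^+ 2))) = 0.
  rewrite -[RHS]sum_g; apply: eq_Rintegral => x; rewrite inE /S6 /unit_sphere /=.
  rewrite (bigD1 i4)//= (bigD1 i2)//= => x1.
  rewrite /h -big_mkcond /= /g.
  have {}x1 : \sum_(i < 6 | (i != i4) && (i != i2)) x 0 i ^+ 2 = 1 - p x.
    by rewrite -x1; ring.
  rewrite sumrB big_split/= -mulr_suml -!mulr_suml -mulr_sumr x1.
  have card4 : #|[pred i | (i != i4) && (i != i2)]| = 4%N.
    apply: (@addnI 2%N); transitivity #|'I_6|; last by rewrite card_ord.
    rewrite -(cardC (pred2 i4 i2)) card2 i42; congr addn.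
    by apply: eq_card => i; rewrite !inE negb_or.
  rewrite sumr_const card4.
  case: (m) => [|m'] /=; rewrite ?exprS ?expr0 natrD natrM -?natr1; ring.
rewrite RintegralD//; [|by apply: integrable; bounded_measurable..].
rewrite RintegralB//; [|by apply: integrable; bounded_measurable..].
rewrite RintegralB//; [|by apply: integrable; bounded_measurable..].
rewrite !RintegralZl//; [|by apply: integrable; bounded_measurable..].
have Em k : E (fun x => p x ^+ k) = sphere_moment k 0.
  by apply: eq_Rintegral => x _; rewrite expr0 mulr1.
rewrite !Em.
have sh k := sphere_moment_shift k 0.
have e1 : E (fun x => p x ^+ m * y x ^+ 2) = sphere_moment m.+1 0 / 2.
  by have := sh m; rewrite /sphere_moment; lra.
(* At [m = 0] the truncated predecessor is harmless because the factor [m] vanishes. *)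
have e2 : 2 * m%:R * E (fun x => p x ^+ m.-1 * y x ^+ 2) = m%:R * sphere_moment m 0.
  case: (m) => [|m']; first by rewrite !(mulr0, mul0r).
  by have := sh m'; rewrite /sphere_moment /= -mulrA mulrCA => ->; rewrite mul1r.
rewrite e1 e2 -(addn3 m) -(addn1 m).
rewrite (natrD _ (2 * m) 4) natrM (natrD _ m 3) (natrD _ m 1) => H.
by apply/eqP; rewrite -subr_eq0 -oppr_eq0 -[X in _ == X]H; apply/eqP; field.
Qed.

End sphere_moments.

(** * Exponential moments *)

Section exponential_partial_sums.
Variable R : realType.
Implicit Types (x t X : R).

Definition exp_sum N x := \sum_(0 <= k < N) x ^+ k / k`!%:R.

Lemma exp_sumS N x : exp_sum N.+1 x = exp_sum N x + x ^+ N / N`!%:R.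
Proof. by rewrite /exp_sum big_nat_recr. Qed.

Lemma exp_sum_cvg x : exp_sum ^~ x @ \oo --> expR x.
Proof. exact: is_cvg_series_exp_coeff. Qed.

Lemma exp_sum_cvg_shift n x : (fun N => exp_sum (n + N) x) @ \oo --> expR x.
Proof.
have := @exp_sum_cvg x; rewrite -(cvg_shiftn n).
by under eq_fun do rewrite addnC.
Qed.

Lemma exp_sum_le N x : 0 <= x -> exp_sum N x <= expR x.
Proof.
move=> x0; apply: (nondecreasing_cvgn_le (u_ := exp_sum ^~ x)).
  by apply: nondecreasing_series => n _ _; rewrite divr_ge0 ?exprn_ge0.
exact: is_cvg_series_exp_coeff.
Qed.

(** Every term of the tail has degree [k >= N], where [t^k <= t^N]. The free parameter serves two
    purposes: [t = 1] gives convergence, and [t = |j|] gives the order of the remainder in [j]. *)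
Lemma expR_remainder N x t X : 0 <= t <= 1 -> 0 <= X -> `|x| <= t * X ->
  `|expR x - exp_sum N x| <= t ^+ N * (expR X - exp_sum N X).
Proof.
move=> /andP[t0 t1] X0 xtX.
have tail M : (N <= M)%N ->
    `|exp_sum M x - exp_sum N x| <= t ^+ N * (expR X - exp_sum N X).
  move=> NM; have split_sum y : exp_sum M y - exp_sum N y =
      \sum_(N <= k < M) y ^+ k / k`!%:R.
    by rewrite /exp_sum (big_cat_nat (leq0n N) NM)/= addrAC subrr add0r.
  rewrite split_sum; apply: le_trans (ler_norm_sum _ _ _) _.
  apply: le_trans (_ : t ^+ N * (exp_sum M X - exp_sum N X) <= _); last first.
    by rewrite ler_wpM2l ?exprn_ge0// lerD2r exp_sum_le.
  rewrite split_sum mulr_sumr big_nat_cond [leRHS]big_nat_cond.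
  apply: ler_sum => k /andP[/andP[Nk _] _].
  rewrite normrM normfV normrX (ger0_norm (ler0n _ _)) mulrA.
  rewrite ler_wpM2r ?invr_ge0//.
  apply: le_trans (_ : (t * X) ^+ k <= _); first by rewrite lerXn2r ?nnegrE// mulr_ge0.
  by rewrite exprMn ler_wpM2r ?exprn_ge0// ler_wiXn2l.
have cv : (fun M => `|exp_sum M x - exp_sum N x|) @ \oo -->
    `|expR x - exp_sum N x|.
  by apply: cvg_norm; apply: cvgB; [exact: exp_sum_cvg|exact: cvg_cst].
rewrite -(cvg_lim _ cv)//; apply: limr_le; first by apply/cvg_ex; eexists; exact: cv.
by exists N => // M /= /tail.
Qed.

End exponential_partial_sums.

Section exponential_moments.
Context {R : realType}.

(** Moments for total mass 1. At [k = 0] these are the moments of the Beta(1, 2) law, the law of the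
    squared length of two coordinates on the five-sphere; the steps in [k] solve
    [sphere_moment_shift]. *)
Fixpoint unit_moment (m k : nat) : R :=
  match k with
  | 0 => 2 / (m.+1%:R * m.+2%:R)
  | 1 => 0
  | k'.+2 => k'.+1%:R / k'.+2%:R * unit_moment m.+1 k'
  end.

Section one_measure.
Variables (s : {measure set 'rV[R]_6 -> \bar R}) (i4 i2 : 'I_6).
Hypothesis i24 : i2 != i4.
Hypothesis sfin : (s (unit_sphere R 6) < +oo)%E.
Hypothesis inv : forall i, i != i4 -> planar_invariant i i4 s.
Let mass := fine (s (unit_sphere R 6)).
Let mS6 : measurable (unit_sphere R 6). Proof. exact: unit_sphere_measurable. Qed.
Local Notation p x := (x 0 i2 ^+ 2 + x 0 i4 ^+ 2).

Lemma sphere_momentE m k : sphere_moment s i4 i2 m k = unit_moment m k * mass.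
Proof.
have : sphere_moment s i4 i2 m k = unit_moment m k * mass /\
   sphere_moment s i4 i2 m k.+1 = unit_moment m k.+1 * mass; last by case.
elim: k m => [|k IH] m; last first.
  have [IH1 IH2] := IH m; split => //=.
  have := sphere_moment_shift i24 sfin inv m k.
  have [-> _] := IH m.+1 => h.
  apply: (@mulfI _ k.+2%:R); first by rewrite pnatr_eq0.
  by rewrite h; field; rewrite -natrD pnatr_eq0.
split; last by rewrite sphere_moment_odd//= mul0r.
elim: m => [|m IH].
  rewrite /sphere_moment; under eq_Rintegral do rewrite !expr0 mulr1.
  by rewrite Rintegral_cst//= -/mass; field.
have := sphere_moment_radial i24 sfin inv m; rewrite IH => h.
apply: (@mulfI _ m.+3%:R); first by rewrite pnatr_eq0.
rewrite h /=; field.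
by rewrite ?nat1r -?natrD !pnatr_eq0.
Qed.

Definition exp_moment z k :=
  \int[s]_(x in unit_sphere R 6) (expR (z * p x) * x 0 i4 ^+ k).

(** Since [0 <= p <= 1], the series of [expR (z * p)] converges uniformly on the sphere. The
    approximants see the measure through its mass alone. *)
Lemma exp_moment_cvg z k : 0 <= z ->
  (fun N => \sum_(0 <= m < N) z ^+ m / m`!%:R * unit_moment m k * mass) @ \oo -->
  exp_moment z k.
Proof.
move=> z0.
have p01 x : unit_sphere R 6 x -> 0 <= p x <= 1.
  rewrite /unit_sphere /= (bigD1 i4)//= (bigD1 i2)//= => <-.
  rewrite addr_ge0 ?sqr_ge0//= addrA [X in X <= _]addrC lerDl.
  by apply: sumr_ge0 => i _; exact: sqr_ge0.
have err N : `|exp_moment z k -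
    \sum_(0 <= m < N) z ^+ m / m`!%:R * unit_moment m k * mass| <=
    (expR z - exp_sum N z) * mass.
  pose h m (x : 'rV[R]_6) := z ^+ m / m`!%:R * (p x ^+ m * x 0 i4 ^+ k).
  have bh m : bounded_measurable (unit_sphere R 6) (h m).
    by rewrite /h; bounded_measurable.
  have -> : \sum_(0 <= m < N) z ^+ m / m`!%:R * unit_moment m k * mass =
    \int[s]_(x in unit_sphere R 6) (\sum_(0 <= m < N) h m x).
    rewrite (Rintegral_sum mS6 sfin)//; apply: eq_bigr => m _.
    rewrite -mulrA -sphere_momentE RintegralZl//.
    by apply: (bounded_measurable_integrable mS6 sfin); bounded_measurable.
  have bs := bounded_measurable_sum N bh.
  rewrite /exp_moment -RintegralB//; last 2 first.
  - by apply: (bounded_measurable_integrable mS6 sfin); bounded_measurable.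
  - exact: (bounded_measurable_integrable mS6 sfin).
  apply: (Rintegral_normr_le mS6 sfin); first by bounded_measurable.
  move=> x Sx; have /andP[p0 p1] := p01 _ Sx.
  have y1 : `|x 0 i4| <= 1.
    rewrite -(ler_pXn2r (ltn0Sn 1)) ?nnegrE// expr1n real_normK ?num_real//.
    by apply: le_trans p1; rewrite lerDr sqr_ge0.
  have -> : \sum_(0 <= m < N) h m x = exp_sum N (z * p x) * x 0 i4 ^+ k.
    rewrite mulr_suml; apply: eq_bigr => m _; rewrite /h exprMn; ring.
  rewrite -mulrBl normrM -[leRHS]mulr1; apply: ler_pM => //; last first.
    by rewrite normrX exprn_ile1.
  apply: le_trans (@expR_remainder _ N _ 1 z _ _ _) _; rewrite ?ler01 ?lexx//.
    by rewrite mul1r ger0_norm ?mulr_ge0// ler_piMr.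
  by rewrite expr1n mul1r.
apply/cvgrPdist_le => e e0.
have cv : (fun N => (expR z - exp_sum N z) * mass) @ \oo -->
    (expR z - expR z) * mass.
  apply: cvgM; last exact: cvg_cst.
  by apply: cvgB; [exact: cvg_cst|exact: exp_sum_cvg].
rewrite subrr mul0r in cv; move/cvgrPdist_le : cv => /(_ _ e0) [M _ HM].
exists M => // N /= /HM; rewrite sub0r normrN => h.
apply: le_trans (err N) _; apply: le_trans h; exact: ler_norm.
Qed.

(** As [m! (m+1) (m+2) = (m+2)!], the moment series is twice the exponential series shifted by
    two. *)
Lemma exp_moment0 z : 0 < z ->
  exp_moment z 0 = 2 * (expR z - 1 - z) / z ^+ 2 * mass.
Proof.
move=> z0; have zn0 : z != 0 by rewrite gt_eqF.
have cv := @exp_moment_cvg z 0 (ltW z0).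
rewrite -(cvg_lim _ cv)//; apply: cvg_lim => //.
have -> : (fun N => \sum_(0 <= m < N) z ^+ m / m`!%:R * unit_moment m 0 * mass) =
    (fun N => 2 * (exp_sum N.+2 z - 1 - z) / z ^+ 2 * mass).
  apply/funext; elim => [|N IH].
    by rewrite big_geq// !exp_sumS /exp_sum big_geq//= !factS fact0 !muln1 expr0 expr1; field.
  rewrite big_nat_recr//= IH [exp_sum N.+3 z]exp_sumS !factS !natrM !exprS expr0; field.
  by rewrite zn0 ?nat1r -?natrD !pnatr_eq0 -?lt0n fact_gt0.
apply: cvgM; last exact: cvg_cst.
apply: cvgM; last exact: cvg_cst.
apply: cvgM; first exact: cvg_cst.
apply: cvgB; last exact: cvg_cst.
apply: cvgB; last exact: cvg_cst.
exact: (exp_sum_cvg_shift 2).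
Qed.

(** Here [unit_moment m 2 = 1 / ((m+2) (m+3))], and [(m+1) / (m+3)! = 1 / (m+2)! - 2 / (m+3)!]
    splits the series into two shifted exponential series. *)
Lemma exp_moment2 z : 0 < z ->
  exp_moment z 2 = ((expR z - 1 - z) / z ^+ 2
    - 2 * (expR z - 1 - z - z ^+ 2 / 2) / z ^+ 3) * mass.
Proof.
move=> z0; have zn0 : z != 0 by rewrite gt_eqF.
have cv := @exp_moment_cvg z 2 (ltW z0).
rewrite -(cvg_lim _ cv)//; apply: cvg_lim => //.
have -> : (fun N => \sum_(0 <= m < N) z ^+ m / m`!%:R * unit_moment m 2 * mass) =
    (fun N => ((exp_sum N.+2 z - 1 - z) / z ^+ 2
    - 2 * (exp_sum N.+3 z - 1 - z - z ^+ 2 / 2) / z ^+ 3) * mass).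
  apply/funext; elim => [|N IH].
    by rewrite big_geq// !exp_sumS /exp_sum big_geq//= !factS fact0 !muln1 expr0 expr1; field.
  rewrite big_nat_recr//= IH [exp_sum N.+4 z]exp_sumS [exp_sum N.+3 z]exp_sumS.
  rewrite !factS !natrM !exprS expr0; field.
  by rewrite zn0 ?nat1r -?natrD !pnatr_eq0 -?lt0n fact_gt0.
apply: cvgM; last exact: cvg_cst.
apply: cvgB.
  apply: cvgM; last exact: cvg_cst.
  apply: cvgB; last exact: cvg_cst.
  apply: cvgB; last exact: cvg_cst.
  exact: (exp_sum_cvg_shift 2).
apply: cvgM; last exact: cvg_cst.
apply: cvgM; first exact: cvg_cst.
apply: cvgB; last exact: cvg_cst.
apply: cvgB; last exact: cvg_cst.
apply: cvgB; last exact: cvg_cst.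
exact: (exp_sum_cvg_shift 3).
Qed.

End one_measure.

(** The substitute for uniqueness of the rotation-invariant measure: it also allows a different pair
    of coordinates on each side. Cross-multiplying by the masses avoids dividing by them. *)
Lemma exp_moment_unique (s s' : {measure set 'rV[R]_6 -> \bar R})
    (i4 i2 j4 j2 : 'I_6) z k : i2 != i4 -> j2 != j4 ->
  (s (unit_sphere R 6) < +oo)%E -> (s' (unit_sphere R 6) < +oo)%E ->
  (forall i, i != i4 -> planar_invariant i i4 s) ->
  (forall i, i != j4 -> planar_invariant i j4 s') -> 0 <= z ->
  exp_moment s i4 i2 z k * fine (s' (unit_sphere R 6)) =
  exp_moment s' j4 j2 z k * fine (s (unit_sphere R 6)).
Proof.
move=> i24 j24 sfin s'fin inv inv' z0.
have scale (u : R^nat) (l r : R) : u @ \oo --> l -> (fun N => u N * r) @ \oo --> l * r.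
  by move=> ul; apply: cvgM => //; exact: cvg_cst.
have cv := scale _ _ (fine (s' (unit_sphere R 6)))
  (exp_moment_cvg i24 sfin inv (k := k) z0).
have cv' := scale _ _ (fine (s (unit_sphere R 6)))
  (exp_moment_cvg j24 s'fin inv' (k := k) z0).
rewrite -(cvg_lim _ cv)// -(cvg_lim _ cv')//; congr (limn _).
apply/funext => N; rewrite !mulr_suml; apply: eq_bigr => m _; ring.
Qed.

End exponential_moments.

Lemma unit_moment_odd (R : realType) m k : odd k -> unit_moment m k = 0 :> R.
Proof.
elim: k.+1 {-2}k (ltnSn k) m => // n IH [|[|l]]//= ln m ol.
rewrite IH ?mulr0//; first exact: ltnW.
by move: ol; rewrite negbK.
Qed.

Lemma exp_moment_odd (R : realType) (s : {measure set 'rV[R]_6 -> \bar R})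
    (i4 i2 : 'I_6) z k : i2 != i4 -> (s (unit_sphere R 6) < +oo)%E ->
  (forall i, i != i4 -> planar_invariant i i4 s) -> 0 <= z -> odd k ->
  exp_moment s i4 i2 z k = 0.
Proof.
move=> i24 sfin inv z0 ok; have cv := exp_moment_cvg i24 sfin inv (k := k) z0.
rewrite -(cvg_lim _ cv)//; apply: cvg_lim => //.
rewrite (_ : (fun _ => _) = fun=> 0); first exact: cvg_cst.
by apply/funext => N; apply: big1 => m _; rewrite unit_moment_odd// mulr0 mul0r.
Qed.

(** * Fourier coefficients of powers of the cosine *)

Section trigonometric_integrals.
Variable R : realType.
Local Notation circle := (`[0, 2 * pi]%classic : set (measurableTypeR R)).
Local Notation "'Int' f" := (\int[@lebesgue_measure R]_(x in `[0, 2 * pi]) f x)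
  (at level 10, f at level 8).

Lemma measurable_circle : measurable circle.
Proof. exact: measurable_itv. Qed.

Lemma circle_measure : (lebesgue_measure circle = (2 * pi)%:E)%E.
Proof.
rewrite lebesgue_measure_itv/= lte_fin mulr_gt0 ?pi_gt0//.
by rewrite -EFinD subr0.
Qed.

Lemma circle_finite : (lebesgue_measure circle < +oo)%E.
Proof. by rewrite circle_measure ltry. Qed.

Lemma Rintegral_circle_cst (r : R) : Int (fun=> r) = r * (2 * pi).
Proof.
rewrite Rintegral_cst; last exact: measurable_circle.
by congr (_ * _); exact: (congr1 fine circle_measure).
Qed.

Lemma bounded_measurable_cos (k : R) :
  bounded_measurable circle (fun x => cos (k * x)).
Proof.
split; last by exists 1 => x _; exact: cos_max.
apply: continuous_measurable_fun => x; apply: continuous_comp.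
  by apply: cvgM; [exact: cvg_cst|exact: cvg_id].
exact: continuous_cos.
Qed.

Lemma bounded_measurable_sin (k : R) :
  bounded_measurable circle (fun x => sin (k * x)).
Proof.
split; last by exists 1 => x _; exact: sin_max.
apply: continuous_measurable_fun => x; apply: continuous_comp.
  by apply: cvgM; [exact: cvg_cst|exact: cvg_id].
exact: continuous_sin.
Qed.

Lemma Rintegral_circle_primitive (f F : R -> R) :
  (forall x : R, is_derive x 1 F (f x)) -> continuous f ->
  Int f = F (2 * pi) - F 0.
Proof.
move=> dF cf; have pi0 : 0 < 2 * pi :> R by rewrite mulr_gt0 ?pi_gt0.
have cF (x : R) : {for x, continuous F}.
  by apply/differentiable_continuous/derivable1_diffP; have [] := dF x.
rewrite /Rintegral (@continuous_FTC2 _ f F)//=.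
- exact: continuous_subspaceT.
- split; first by move=> x _; have [] := dF x.
  + by apply: cvg_at_right_filter; exact: cF.
  + by apply: cvg_at_left_filter; exact: cF.
- by move=> x _; rewrite derive1E; have [_ ->] := dF x.
Qed.

Lemma Rintegral_cosn n : Int (fun x => cos (n%:R * x)) = 2 * pi * (n == 0%N)%:R.
Proof.
case: n => [|n].
  under eq_Rintegral do rewrite mul0r cos0.
  by rewrite Rintegral_circle_cst mul1r mulr1.
have dF (x : R) :
    is_derive x 1 (fun x => sin (n.+1%:R * x) / n.+1%:R) (cos (n.+1%:R * x)).
  apply: is_derive_eq; rewrite /GRing.scale /=; field.
  by rewrite nat1r pnatr_eq0.
have cf : continuous (fun x : R => cos (n.+1%:R * x)).
  move=> x; apply: continuous_comp; last exact: continuous_cos.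
  by apply: cvgM; [exact: cvg_cst|exact: cvg_id].
rewrite (Rintegral_circle_primitive dF cf) mulr0 sin0 mul0r subr0 mulr0.
have -> : n.+1%:R * (2 * pi) = 0 + (pi *+ 2) *+ n.+1 :> R.
  by rewrite add0r -(mulr_natl pi 2) -[RHS]mulr_natl.
by rewrite (periodicn (@sinD2pi R)) sin0 mul0r.
Qed.

Lemma Rintegral_sinn n : Int (fun x => sin (n%:R * x)) = 0.
Proof.
case: n => [|n].
  under eq_Rintegral do rewrite mul0r sin0.
  by rewrite Rintegral_circle_cst mul0r.
have dF (x : R) :
    is_derive x 1 (fun x => - cos (n.+1%:R * x) / n.+1%:R) (sin (n.+1%:R * x)).
  apply: is_derive_eq; rewrite /GRing.scale /=; field.
  by rewrite nat1r pnatr_eq0.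
have cf : continuous (fun x : R => sin (n.+1%:R * x)).
  move=> x; apply: continuous_comp; last exact: continuous_sin.
  by apply: cvgM; [exact: cvg_cst|exact: cvg_id].
rewrite (Rintegral_circle_primitive dF cf).
have -> : n.+1%:R * (2 * pi) = n.+1%:R * 0 + (pi *+ 2) *+ n.+1 :> R.
  by rewrite mulr0 add0r -(mulr_natl pi 2) -[RHS]mulr_natl.
by rewrite (periodicn (@cosD2pi R)) subrr.
Qed.

Definition half_cos (x : R) := cos (2^-1 * x).

Lemma bounded_measurable_half_cos : bounded_measurable circle half_cos.
Proof. exact: bounded_measurable_cos. Qed.

Lemma half_cos_sqr x : half_cos x ^+ 2 = (1 + cos x) / 2.
Proof.
rewrite /half_cos; have := cos_mulr2n (2^-1 * x).
have -> : 2^-1 * x *+ 2 = x by rewrite -mulr_natl mulrA mulfV// mul1r.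
by move=> ->; rewrite -mulr_natl; field.
Qed.

(** Even powers suffice because odd moments in [n_4] vanish. Such a power is a polynomial of degree
    [m] in [cos x], so its harmonics stop at [m]. *)
Definition cos_coef m n := Int (fun x => cos (n%:R * x) * half_cos x ^+ (2 * m)).
Definition sin_coef m n := Int (fun x => sin (n%:R * x) * half_cos x ^+ (2 * m)).

Let bc n := bounded_measurable_cos n%:R.
Let bs n := bounded_measurable_sin n%:R.
Let bh := bounded_measurable_half_cos.

Lemma circle_integrable f : bounded_measurable circle f ->
  lebesgue_measure.-integrable circle (EFin \o f).
Proof.
exact: (bounded_measurable_integrable measurable_circle circle_finite).
Qed.

(** Trades one factor [half_cos ^ 2 = (1 + cos) / 2] for a combination of the harmonic and its two
    neighbours, for cosines and sines alike. *)
Let coef_combination (f g h k : R -> R) m :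
  bounded_measurable circle f -> bounded_measurable circle g ->
  bounded_measurable circle h ->
  (forall x, k x * (1 + cos x) / 2 = f x / 2 + (g x + h x) / 4) ->
  Int (fun x => k x * half_cos x ^+ (2 * m.+1)) =
  Int (fun x => f x * half_cos x ^+ (2 * m)) / 2 +
  (Int (fun x => g x * half_cos x ^+ (2 * m)) +
   Int (fun x => h x * half_cos x ^+ (2 * m))) / 4.
Proof.
move=> bf bg bh' kE.
have bP (u : R -> R) : bounded_measurable circle u ->
    bounded_measurable circle (fun x => u x * half_cos x ^+ (2 * m)).
  by move=> bu; apply: bounded_measurableM => //; exact: bounded_measurableX.
rewrite -RintegralD ?measurable_circle//; [|exact/circle_integrable/bP..].
have bgh := bounded_measurableD (bP _ bg) (bP _ bh').
rewrite -RintegralZr ?measurable_circle//; last exact/circle_integrable/bP.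
rewrite -RintegralZr ?measurable_circle//; last exact: circle_integrable.
rewrite -RintegralD ?measurable_circle//; last 2 first.
- apply/circle_integrable/bounded_measurableM; first exact: bP.
  exact: bounded_measurable_cst.
- by apply/circle_integrable/bounded_measurableM => //; exact: bounded_measurable_cst.
apply: eq_Rintegral => x _; rewrite mulnS exprD half_cos_sqr.
transitivity (k x * (1 + cos x) / 2 * half_cos x ^+ (2 * m)); first by ring.
by rewrite kE; ring.
Qed.

Lemma cos_coefS m n :
  cos_coef m.+1 n.+1 = cos_coef m n.+1 / 2 + (cos_coef m n.+2 + cos_coef m n) / 4.
Proof.
apply: coef_combination => // x.
rewrite -[n.+2%:R]natr1 -[n.+1%:R]natr1.
have -> : n%:R * x = (n%:R + 1) * x - x by ring.
have -> : (n%:R + 1 + 1) * x = (n%:R + 1) * x + x by ring.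
by rewrite cosB cosD; field.
Qed.

Lemma cos_coefS0 m : cos_coef m.+1 0 = cos_coef m 0 / 2 + cos_coef m 1 / 2.
Proof.
transitivity (cos_coef m 0 / 2 + (cos_coef m 1 + cos_coef m 1) / 4).
  apply: coef_combination => // x.
  by rewrite mul0r mul1r cos0; field.
by field.
Qed.

Lemma sin_coefS m n :
  sin_coef m.+1 n.+1 = sin_coef m n.+1 / 2 + (sin_coef m n.+2 + sin_coef m n) / 4.
Proof.
apply: coef_combination => // x.
rewrite -[n.+2%:R]natr1 -[n.+1%:R]natr1.
have -> : n%:R * x = (n%:R + 1) * x - x by ring.
have -> : (n%:R + 1 + 1) * x = (n%:R + 1) * x + x by ring.
by rewrite sinB sinD; field.
Qed.

Lemma cos_coef0 n : cos_coef 0 n = 2 * pi * (n == 0%N)%:R.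
Proof.
by rewrite -Rintegral_cosn; apply: eq_Rintegral => x _; rewrite muln0 expr0 mulr1.
Qed.

Lemma sin_coef_eq0 m n : sin_coef m n = 0.
Proof.
elim: m n => [|m IH] [|n].
- under [LHS]eq_Rintegral do rewrite mul0r sin0 mul0r.
  by rewrite Rintegral_circle_cst mul0r.
- rewrite -[RHS](Rintegral_sinn n.+1).
  by apply: eq_Rintegral => x _; rewrite muln0 expr0 mulr1.
- under [LHS]eq_Rintegral do rewrite mul0r sin0 mul0r.
  by rewrite Rintegral_circle_cst mul0r.
- by rewrite sin_coefS !IH; ring.
Qed.

Lemma cos_coef_eq0 m n : (m < n)%N -> cos_coef m n = 0.
Proof.
elim: m n => [|m IH] [|n]// mn; first by rewrite cos_coef0 mulr0.
by rewrite cos_coefS (IH n)// (IH n.+1) 1?ltnW// (IH n.+2) 1?ltnW 1?ltnW//; ring.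
Qed.

(** In general the coefficient is [2 pi C(2 m, m - n) / 4^m] with a binomial coefficient; the cases
    [m = n] and [m = n + 1] are the two orders that the sum rule compares. *)
Lemma cos_coef_diag n : cos_coef n n = 2 * pi / 4 ^+ n.
Proof.
elim: n => [|n IH]; first by rewrite cos_coef0 eqxx mulr1 expr0 divr1.
rewrite cos_coefS IH !cos_coef_eq0// exprS; field.
by rewrite expf_neq0// pnatr_eq0.
Qed.

Lemma cos_coef_subdiag n :
  cos_coef n.+1 n = 2 * pi * (2 * n + 2)%:R / 4 ^+ n.+1.
Proof.
elim: n => [|n IH].
  by rewrite cos_coefS0 cos_coef_diag cos_coef_eq0// expr0 expr1; field.
rewrite cos_coefS IH cos_coef_diag cos_coef_eq0//.
rewrite !(natrD, natrM) -[n.+1%:R]natr1 [in RHS]exprS; field.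
by rewrite expf_neq0// pnatr_eq0.
Qed.

End trigonometric_integrals.

(** * Expectations of infinite products *)

Lemma big_nat_recr_cond (A : Type) (idx : A) (op : Monoid.law idx) n
    (P : pred nat) (F : nat -> A) :
  \big[op/idx]_(0 <= k < n.+1 | P k) F k =
  op (\big[op/idx]_(0 <= k < n | P k) F k) (if P n then F n else idx).
Proof. by rewrite big_mkcond big_nat_recr//= -big_mkcond. Qed.

Section infinite_products.
Context {R : realType}.
Variables (I : pred nat) (a : nat -> R).
Hypothesis a0 : forall k, I k -> 0 <= a k.

Let prodn t n := \prod_(0 <= k < n | I k) (1 + t * a k).
Let sumn n := \sum_(0 <= k < n | I k) a k.

Let prodn_ge1 t n : 0 <= t -> 1 <= prodn t n.
Proof.
move=> t0; elim: n => [|n IH]; first by rewrite /prodn big_geq.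
rewrite /prodn big_nat_recr_cond/= -/(prodn t n).
case: ifPn => [In|_]; last by rewrite mulr1.
have p0 := le_trans ler01 IH.
by apply: le_trans IH _; rewrite ler_peMr// lerDl mulr_ge0// a0.
Qed.

Let prodn_nondecreasing t : 0 <= t ->
  {homo (fun n => (prodn t n)%:E) : m n / (m <= n)%N >-> (m <= n)%E}.
Proof.
move=> t0; apply/nondecreasing_seqP => n; rewrite lee_fin.
rewrite /prodn big_nat_recr_cond/= -/(prodn t n).
case: ifPn => [In|_]; last by rewrite mulr1.
have p0 := le_trans ler01 (prodn_ge1 n t0).
by rewrite ler_peMr// lerDl mulr_ge0// a0.
Qed.

Lemma eprod1p_cvg t : 0 <= t ->
  (fun n => (\prod_(0 <= k < n | I k) (1 + t * a k))%:E) @ \oo -->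
  eprod1p I (fun k => t * a k).
Proof. by move=> t0; exact/ereal_nondecreasing_is_cvgn/prodn_nondecreasing. Qed.

Let sum_cvg : (fun n => (sumn n)%:E) @ \oo -->
  (\sum_(0 <= k <oo | I k) (a k)%:E)%E.
Proof.
under eq_fun do rewrite -sumEFin.
by apply: is_cvg_nneseries => n _ In; rewrite lee_fin a0.
Qed.

(** The middle bound makes the induction close: a new factor [1 + t b] adds [t b p] to the product
    [p], and [p <= 1 + t q] bounds this by [t b + t^2 b q], which is what the last bound gains. *)
Let finite_bounds t n : 0 <= t <= 1 ->
  [/\ 1 + t * sumn n <= prodn t n,
      prodn t n <= 1 + t * prodn 1 n &
      prodn t n <= 1 + t * sumn n + t ^+ 2 * prodn 1 n].
Proof.
move=> /andP[t0 t1]; elim: n => [|n [L U Q]].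
  rewrite /sumn /prodn !big_geq// mulr0 addr0 mulr1 mulr1 lexx lerDl t0.
  by split => //; rewrite lerDl sqr_ge0.
have p1 := prodn_ge1 n t0; have q1 := prodn_ge1 n ler01.
have pq : prodn t n <= prodn 1 n.
  rewrite /prodn; apply: ler_prod => k Ik.
  by rewrite mul1r lerD2l addr_ge0 ?mulr_ge0 ?a0//= ler_piMl ?a0.
rewrite /sumn /prodn !big_nat_recr_cond/= -!/(prodn _ _) -!/(sumn _).
case: ifPn => [In|_]; last by rewrite addr0 !mulr1.
rewrite mul1r; move: pq p1 q1 L U Q (a0 In); clear -t0 t1.
move: (prodn t n) (prodn 1 n) (sumn n) (a n) => p q S b pq p1 q1 L U Q b0.
have tb : 0 <= t * b by rewrite mulr_ge0.
have h1 : 0 <= t * b * (p - 1) by rewrite mulr_ge0// subr_ge0.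
have h2 : 0 <= t * b * (q - p) by rewrite mulr_ge0// subr_ge0.
have h3 : 0 <= t * b * (1 + t * q - p) by rewrite mulr_ge0// subr_ge0.
split; nra.
Qed.

Lemma eprod1p_bounds t : 0 <= t <= 1 ->
  (1 + t%:E * (\sum_(0 <= k <oo | I k) (a k)%:E) <=
     eprod1p I (fun k => t * a k)%R)%E /\
  (eprod1p I (fun k => t * a k)%R <=
   1 + t%:E * (\sum_(0 <= k <oo | I k) (a k)%:E) +
   (t ^+ 2)%:E * eprod1p I (fun k => 1 * a k)%R)%E.
Proof.
move=> t01; have /andP[t0 t1] := t01.
have sge0 : (0 <= \sum_(0 <= k <oo | I k) (a k)%:E)%E.
  by apply: nneseries_ge0 => k _ Ik; rewrite lee_fin a0.
have cvL : (fun n => (1 + t * sumn n)%:E) @ \oo -->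
    (1 + t%:E * (\sum_(0 <= k <oo | I k) (a k)%:E))%E.
  under eq_fun do rewrite EFinD EFinM.
  apply: cvgeD; first by rewrite fin_num_adde_defr.
    exact: cvg_cst.
  by apply: cvgeZl.
have cvP := eprod1p_cvg t0; have cvQ := eprod1p_cvg ler01.
have Pge0 : (0 <= eprod1p I (fun k => 1 * a k)%R)%E.
  rewrite -(cvg_lim _ cvQ)//; apply: lime_ge; first by apply/cvg_ex; eexists; exact: cvQ.
  by apply: nearW => n; rewrite lee_fin (le_trans ler01 (prodn_ge1 n ler01)).
have cvU : (fun n => (1 + t * sumn n + t ^+ 2 * prodn 1 n)%:E) @ \oo -->
    (1 + t%:E * (\sum_(0 <= k <oo | I k) (a k)%:E) +
     (t ^+ 2)%:E * eprod1p I (fun k => 1 * a k)%R)%E.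
  under eq_fun do rewrite EFinD [X in (_ + X)%E]EFinM.
  apply: cvgeD; [|exact: cvL|by apply: cvgeZl].
  by rewrite ge0_adde_def// inE ?adde_ge0 ?mule_ge0// lee_fin sqr_ge0.
have exc (u : nat -> \bar R) (l : \bar R) : u @ \oo --> l -> cvgn u.
  by move=> ul; apply/cvg_ex; exists l.
split.
- rewrite -(cvg_lim _ cvL)// -[leRHS](cvg_lim _ cvP)//.
  apply: lee_lim; [exact: exc cvL|exact: exc cvP|].
  by apply: nearW => n; rewrite lee_fin; have [] := finite_bounds n t01.
- rewrite -[leRHS](cvg_lim _ cvU)// -[leLHS](cvg_lim _ cvP)//.
  apply: lee_lim; [exact: exc cvP|exact: exc cvU|].
  by apply: nearW => n; rewrite lee_fin; have [] := finite_bounds n t01.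
Qed.

End infinite_products.

Section expected_products.
Context {d : measure_display} {Omega : measurableType d} {R : realType}.
Variables (P : probability Omega R) (I : pred nat) (a : nat -> Omega -> R).
Hypothesis ma : forall k, I k -> measurable_fun [set: Omega] (a k).
Hypothesis a0 : forall k w, I k -> 0 <= a k w.

Let F t := (\int[P]_w eprod1p I (fun k => t * a k w)%R)%E.
Let T := (\int[P]_w (\sum_(0 <= k <oo | I k) (a k w)%:E))%E.

Lemma measurable_eprod1p t : 0 <= t ->
  measurable_fun [set: Omega] (fun w => eprod1p I (fun k => t * a k w)).
Proof.
move=> t0.
apply: (@emeasurable_fun_cvg _ _ _ _
  (fun n w => (\prod_(0 <= k < n | I k) (1 + t * a k w))%:E)); last first.
  by move=> w _; apply: eprod1p_cvg => // k Ik; exact: a0.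
move=> n; apply/measurable_EFinP; elim: n => [|n IH].
  by under eq_fun do rewrite big_geq//; exact: measurable_cst.
under eq_fun do rewrite big_nat_recr_cond//.
apply: measurable_funM => //.
case: (boolP (I n)) => In; last exact: measurable_cst.
by apply: measurable_funD => //; apply: measurable_funM => //; exact: ma.
Qed.

Lemma measurable_nneseries :
  measurable_fun [set: Omega] (fun w => \sum_(0 <= k <oo | I k) (a k w)%:E)%E.
Proof.
have := @ge0_emeasurable_sum _ Omega R setT (fun k w => (a k w)%:E) I.
apply => k.
- by move=> w _ Ik; rewrite lee_fin a0.
- by move=> Ik; apply/measurable_EFinP; exact: ma.
Qed.

(** The lower bound at [t = 1] gives [T <= F 1 < +oo], and the upper bound then makes every [F t]
    finite. The explicit error [t^2 F 1] takes the place of differentiating the expected product at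
    [t = 0]. *)
Lemma expected_eprod1p_bounds : (F 1 < +oo)%E ->
  T \is a fin_num /\
  forall t, 0 <= t <= 1 ->
    1 + t * fine T <= fine (F t) <= 1 + t * fine T + t ^+ 2 * fine (F 1).
Proof.
move=> F1.
have b t w := @eprod1p_bounds R I (a^~ w) (fun k Ik => a0 w Ik) t.
have sge0 w : (0 <= \sum_(0 <= k <oo | I k) (a k w)%:E)%E.
  by apply: nneseries_ge0 => k _ Ik; rewrite lee_fin a0.
have pge0 t w : 0 <= t <= 1 -> (0 <= eprod1p I (fun k => t * a k w)%R)%E.
  move=> t01; have [lb _] := b _ w t01; apply: le_trans lb.
  by rewrite adde_ge0// mule_ge0// lee_fin; case/andP: t01.
have one01 : 0 <= (1 : R) <= 1 by rewrite ler01 lexx.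
have mp := measurable_eprod1p; have ms := measurable_nneseries.
have T0 : (0 <= T)%E by apply: integral_ge0 => w _; exact: sge0.
have intL t : 0 <= t -> (\int[P]_w (1 + t%:E * (\sum_(0 <= k <oo | I k) (a k w)%:E)) =
    1 + t%:E * T)%E.
  move=> t0; rewrite ge0_integralD//=.
  - rewrite integral_cst// mul1e -ge0_integralZl_EFin//.
    by congr (_ + _)%E; exact: probability_setT.
  - by move=> w _; rewrite mule_ge0.
  - exact: measurable_funeM.
have lower t : 0 <= t <= 1 -> (1 + t%:E * T <= F t)%E.
  move=> t01; have /andP[t0 t1] := t01; rewrite -intL//.
  apply: ge0_le_integral => //.
  - by move=> w _; rewrite adde_ge0// mule_ge0.
  - by apply: emeasurable_funD => //; exact: measurable_funeM.
  - exact: mp.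
  - by move=> w _; have [] := b _ w t01.
have upper t : 0 <= t <= 1 ->
    (F t <= 1 + t%:E * T + (t ^+ 2)%:E * F 1)%E.
  move=> t01; have /andP[t0 t1] := t01; rewrite -intL//.
  rewrite -ge0_integralZl_EFin ?sqr_ge0//; last 2 first.
  - by move=> w _; exact: pge0.
  - exact: mp.
  rewrite -ge0_integralD//; last 4 first.
  - by move=> w _; rewrite adde_ge0// mule_ge0.
  - by apply: emeasurable_funD => //; exact: measurable_funeM.
  - by move=> w _; rewrite mule_ge0 ?lee_fin ?sqr_ge0// pge0.
  - by apply: measurable_funeM; exact: mp.
  apply: ge0_le_integral => //.
  - by move=> w _; exact: pge0.
  - exact: mp.
  - apply: emeasurable_funD; first by apply: emeasurable_funD => //; exact: measurable_funeM.
    by apply: measurable_funeM; exact: mp.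
  - by move=> w _; have [] := b _ w t01.
have Tfin : T \is a fin_num.
  rewrite ge0_fin_numE//; apply: le_lt_trans F1; apply: le_trans (lower 1 one01).
  by rewrite mul1e leeDr.
have Ffin t : 0 <= t <= 1 -> F t \is a fin_num.
  move=> t01; rewrite ge0_fin_numE; last by apply: integral_ge0 => w _; exact: pge0.
  apply: le_lt_trans (upper _ t01) _.
  rewrite -(fineK Tfin) -[F 1]fineK ?ltry//.
  by rewrite ge0_fin_numE//; apply: integral_ge0 => w _; exact: pge0.
split => // t t01; have := lower _ t01; have := upper _ t01.
rewrite -(fineK Tfin) -(fineK (Ffin _ t01)) -(fineK (Ffin _ one01)).
by rewrite -!EFinM -!EFinD !lee_fin => -> ->.
Qed.

End expected_products.

(** * The image of SU(4) on the five-sphere *)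

Section four_by_four.
Variable K : comNzRingType.

Lemma sum_ord4 (V : nmodType) (F : 'I_4 -> V) :
  \sum_(k < 4) F k = F (inord 0) + F (inord 1) + F (inord 2) + F (inord 3).
Proof.
transitivity (\sum_(k < 4) F (inord k)).
  by apply: eq_bigr => k _; rewrite inord_val.
by rewrite !big_ord_recr big_ord0 /= add0r.
Qed.

(** With entries indexed by [nat], minors are obtained by reducing [bump], without ordinals. *)
Definition natmx n (f : nat -> nat -> K) : 'M[K]_n := \matrix_(i, j) f i j.

Lemma det_natmxS n (f : nat -> nat -> K) :
  \det (natmx n.+1 f) =
  \sum_(k < n.+1) f 0%N k * ((-1) ^+ k *
    \det (natmx n (fun a b => f a.+1 (bump k b)))).
Proof.
rewrite (expand_det_row _ ord0); apply: eq_bigr => k _.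
rewrite mxE /cofactor add0n; congr (_ * (_ * \det _)).
by apply/matrixP => i j; rewrite !mxE /= [bump 0 i]/bump leq0n add1n.
Qed.

(** Laplace expansion along the first two rows. *)
Lemma det4E (f : nat -> nat -> K) :
  \det (natmx 4 f) =
    (f 0 0 * f 1 1 - f 0 1 * f 1 0) * (f 2 2 * f 3 3 - f 2 3 * f 3 2)
  - (f 0 0 * f 1 2 - f 0 2 * f 1 0) * (f 2 1 * f 3 3 - f 2 3 * f 3 1)
  + (f 0 0 * f 1 3 - f 0 3 * f 1 0) * (f 2 1 * f 3 2 - f 2 2 * f 3 1)
  + (f 0 1 * f 1 2 - f 0 2 * f 1 1) * (f 2 0 * f 3 3 - f 2 3 * f 3 0)
  - (f 0 1 * f 1 3 - f 0 3 * f 1 1) * (f 2 0 * f 3 2 - f 2 2 * f 3 0)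
  + (f 0 2 * f 1 3 - f 0 3 * f 1 2) * (f 2 0 * f 3 1 - f 2 1 * f 3 0).
Proof.
by rewrite !(det_natmxS, big_ord_recr, big_ord0, det_mx00) /= /bump /=; ring.
Qed.

End four_by_four.

Notation sigma_entry U i j := (Sigma U (inord i) (inord j)).

Section sigma_entries.
Variable R : realType.
Local Notation C := R[i].
Implicit Types U : 'M[C]_4.

Lemma Sigma_dE : Sigma_d R = \matrix_(i < 4, j < 4)
  (((i == 1 :> nat) && (j == 0 :> nat))%:R - ((i == 0 :> nat) && (j == 1 :> nat))%:R
  + ((i == 2 :> nat) && (j == 3 :> nat))%:R - ((i == 3 :> nat) && (j == 2 :> nat))%:R).
Proof.
apply/matrixP => i j; rewrite mxE /Sigma_d.
case: (@split_ordP 2 2 i) => i' ->; case: (@split_ordP 2 2 j) => j' ->.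
all: rewrite /block_mx ?(col_mxEu, col_mxEd) ?(row_mxEl, row_mxEr) !mxE /=.
all: case: i' => [[|[|[]]]]//= ?; case: j' => [[|[|[]]]]//= ?.
all: rewrite ?(subr0, sub0r, addr0, add0r, oppr0, opprK, subrr) //.
Qed.

Lemma sigma_entryE U i j : let u a b := U (inord a) (inord b) in
  sigma_entry U i j =
  u i 1%N * u j 0%N - u i 0%N * u j 1%N + u i 2 * u j 3 - u i 3 * u j 2.
Proof.
rewrite /= /Sigma mxE sum_ord4 !mxE !sum_ord4 Sigma_dE !mxE !inordK//=.
ring.
Qed.

Lemma sigma_entryN U i j : sigma_entry U i j = - sigma_entry U j i.
Proof. by rewrite !sigma_entryE /=; ring. Qed.

Lemma sigma_entryii U i : sigma_entry U i i = 0.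
Proof. by rewrite !sigma_entryE /=; ring. Qed.

(** This is [Pf (U A U^T) = det U Pf A] with [Pf Sigma_d = -1], checked as a polynomial identity in
    the entries of [U]. *)
Lemma sigma_pfaffian U :
  sigma_entry U 0 1 * sigma_entry U 2 3 - sigma_entry U 0 2 * sigma_entry U 1 3
  + sigma_entry U 0 3 * sigma_entry U 1 2 = - \det U.
Proof.
have -> : \det U = \det (natmx 4 (fun i j => U (inord i) (inord j))).
  congr determinant.
  by apply/matrixP => i j; rewrite mxE !inord_val.
rewrite det4E !sigma_entryE /=; ring.
Qed.

Lemma Sigma_unitary U : U \is unitarymx -> Sigma U \is unitarymx.
Proof.
move=> uU; rewrite /Sigma; apply: mul_unitarymx; last by rewrite trmx_unitary.
apply: mul_unitarymx => //; apply/unitarymxP; rewrite Sigma_dE.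
apply/matrixP => i j; rewrite !mxE sum_ord4 !mxE !inordK//=.
case: i => [[|[|[|[|]]]]]//= ?; case: j => [[|[|[|[|]]]]]//= ?.
all: rewrite ?(subr0, sub0r, addr0, add0r, mul0r, mulr0, rmorph0, rmorph1, rmorphN, oppr0).
all: by rewrite ?(mulr1, mul1r, mulrN, mulNr, opprK, oppr0, addr0, add0r).
Qed.

End sigma_entries.

Section sigma_coordinates.
Variable R : realType.
Local Notation C := R[i].
Implicit Types U : 'M[C]_4.

(* A unitary antisymmetric matrix with Pfaffian -1 is minus the adjoint of its
   Pfaffian adjugate; only the first column of that identity is needed. *)
Lemma sigma_dual U : SU R 4 U ->
  [/\ sigma_entry U 2 3 = - (sigma_entry U 0 1)^*%C,
      sigma_entry U 1 3 = (sigma_entry U 0 2)^*%C &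
      sigma_entry U 1 2 = - (sigma_entry U 0 3)^*%C].
Proof.
move=> [uU dU]; have uS := Sigma_unitary uU.
have pf := sigma_pfaffian U; rewrite dU in pf.
have sN i j : sigma_entry U i j = - sigma_entry U j i by exact: sigma_entryN.
have s0 i : sigma_entry U i i = 0 by exact: sigma_entryii.
move: (Sigma U) uS pf sN s0 => S uS pf sN s0.
pose s i j := S (inord i) (inord j).
(* The first column of the Pfaffian adjugate: row 0 of [S] pairs with it to the Pfaffian, the other
   rows to 0. *)
pose v : 'cV[C]_4 := \col_i nth 0 [:: 0; s 2 3; - s 1%N 3; s 1%N 2] i.
have Sv : S *m v = - delta_mx (inord 0) 0.
  apply/matrixP => i j; rewrite !mxE sum_ord4 !mxE !inordK//= ord1 eqxx andbT.
  rewrite -(inord_val i) /s.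
  have -> : (inord i == inord 0 :> 'I_4) = (i == 0%N :> nat).
    by rewrite -val_eqE /= !inordK.
  case: i => [[|[|[|[|]]]]]//= _; rewrite ?s0 ?oppr0.
  - by rewrite -pf; ring.
  - by rewrite (sN 1%N 0%N); ring.
  - by rewrite (sN 2 1%N); ring.
  - by rewrite (sN 3 1%N) (sN 3 2); ring.
have vE : v = - (S^t* *m delta_mx (inord 0) 0).
  rewrite -mulmxN -Sv mulmxA.
  have /unitarymxP : S^t* \is unitarymx by rewrite trmxC_unitary.
  by rewrite trmxCK => ->; rewrite mul1mx.
have ve (k : nat) : (k < 4)%N -> v (inord k) 0 = - (s 0%N k)^*%C.
  move=> k4; rewrite vE !mxE (bigD1 (inord 0))//= big1 => [|l /negPf l0].
    by rewrite !mxE !eqxx mulr1 addr0.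
  by rewrite !mxE l0 mulr0.
have := ve 1%N isT; have := ve 2 isT; have := ve 3 isT.
rewrite !mxE !inordK//= => e3 e2 e1; split; [exact: e1| |exact: e3].
by apply: oppr_inj; exact: e2.
Qed.

Lemma sigma_row0 U : SU R 4 U ->
  sigma_entry U 0 1 * (sigma_entry U 0 1)^*%C +
  sigma_entry U 0 2 * (sigma_entry U 0 2)^*%C +
  sigma_entry U 0 3 * (sigma_entry U 0 3)^*%C = 1.
Proof.
move=> [uU _]; have /unitarymxP/matrixP/(_ (inord 0) (inord 0)) := Sigma_unitary uU.
have := @sigma_entryii R U 0; move: (Sigma U) => S s00.
rewrite mxE sum_ord4 !mxE eqxx s00 mul0r add0r.
by move=> h; exact: h.
Qed.

(** Coordinate 0, the real part of Sigma_01, plays the role of [n_4], and coordinate 1, its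
    imaginary part, that of [n_2]. *)
Definition sigma_coords U : 'rV[R]_6 :=
  \row_i nth 0 [:: complex.Re (sigma_entry U 0 1); complex.Im (sigma_entry U 0 1);
                   complex.Re (sigma_entry U 0 2); complex.Im (sigma_entry U 0 2);
                   complex.Re (sigma_entry U 0 3); complex.Im (sigma_entry U 0 3)] i.

Local Notation n0 U := (sigma_coords U 0 (inord 0)).
Local Notation n1 U := (sigma_coords U 0 (inord 1)).

Lemma sigma_coords_sphere U : SU R 4 U -> unit_sphere R 6 (sigma_coords U).
Proof.
move=> /sigma_row0/(congr1 (@complex.Re R)).
rewrite /sigma_coords; move: (Sigma U) => S.
rewrite /unit_sphere /= !big_ord_recr big_ord0 /= !mxE /=.
case: (S (inord 0) (inord 1)) (S (inord 0) (inord 2)) (S (inord 0) (inord 3)) =>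
  [? ?] [? ?] [? ?] /= <-.
by ring.
Qed.

(** By antisymmetry the trace is [2 (Sigma_01 - Sigma_23)], and [sigma_dual] makes the second entry
    minus the conjugate of the first. *)
Lemma trace_Sigma_d U : SU R 4 U ->
  \tr (Sigma_d R *m Sigma U) = (4 * n0 U)%:C.
Proof.
move=> sU; have [s23 _ _] := sigma_dual sU.
have sN := @sigma_entryN R U.
rewrite /sigma_coords; move: (Sigma U) s23 sN => S s23 sN.
rewrite /mxtrace sum_ord4 !mxE !sum_ord4 Sigma_dE !mxE !inordK//=.
rewrite !(subr0, sub0r, add0r, addr0, mul0r, oppr0) (sN 3 2) (sN 1%N 0%N) s23.
case: (S (inord 0) (inord 1)) => x y /=; simpc.
by congr (_ +i* _); ring.
Qed.

Lemma BmxE : Bmx R =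
  \matrix_(k < 4, l < 4) ((k == l)%:R * (if (l < 2)%N then 1 else -1)).
Proof.
apply/matrixP => k l; rewrite [RHS]mxE /Bmx.
case: (@split_ordP 2 2 k) => k' ->; case: (@split_ordP 2 2 l) => l' ->.
- by rewrite (@block_mxEul _ 2 2 2 2) mxE -[LHS]mulr1; case: l'.
- rewrite (@block_mxEur _ 2 2 2 2) mxE; case: k' l' => [k' ?] [l' ?].
  by rewrite -val_eqE /= ltn_eqF ?mul0r// ltn_addr.
- rewrite (@block_mxEdl _ 2 2 2 2) mxE; case: k' l' => [k' ?] [l' ?].
  by rewrite -val_eqE /= gtn_eqF ?mul0r// ltn_addr.
- rewrite (@block_mxEdr _ 2 2 2 2) !mxE; case: k' l' => [k' ?] [l' ?].
  by rewrite -!val_eqE /= eqn_add2l mulrN1.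
Qed.

Lemma mulmx_Bmx (A : 'M[C]_4) (i : 'I_4) (j : nat) : (j < 4)%N ->
  (A *m Bmx R) i (inord j) = A i (inord j) * (if (j < 2)%N then 1 else -1).
Proof.
move=> j4.
rewrite mxE (bigD1 (inord j))//= big1 => [|k /negPf kj].
  by rewrite BmxE mxE eqxx inordK// mul1r addr0.
by rewrite BmxE mxE kj mul0r mulr0.
Qed.

(** The trace is the sum of the [|Sigma_ij|^2], with sign plus inside the diagonal blocks and minus
    outside. Duality gives [4 |Sigma_01|^2 - 4 (|Sigma_02|^2 + |Sigma_03|^2)], and the sphere
    equation removes the last two terms. *)
Lemma trace_SigmaB U : SU R 4 U ->
  \tr (Sigma U *m Bmx R *m (Sigma U)^t* *m Bmx R) =
  (8 * (n1 U ^+ 2 + n0 U ^+ 2) - 4)%:C.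
Proof.
move=> sU; have [s23 s13 s12] := sigma_dual sU.
have sN := @sigma_entryN R U.
have sii := @sigma_entryii R U.
have := congr1 (@complex.Re R) (sigma_row0 sU).
rewrite /sigma_coords; move: (Sigma U) s23 s13 s12 sN sii => S s23 s13 s12 sN sii.
rewrite /mxtrace sum_ord4 !mulmx_Bmx//= !mxE !sum_ord4 !mulmx_Bmx//=.
rewrite !mxE !inordK//= !sii.
rewrite (sN 1%N 0%N) (sN 2 0%N) (sN 3 0%N) (sN 2 1%N) (sN 3 1%N) (sN 3 2).
rewrite s23 s13 s12.
case: (S (inord 0) (inord 1)) (S (inord 0) (inord 2)) (S (inord 0) (inord 3)) =>
  [x y] [x' y'] [x'' y''] /= h.
apply/eqP; rewrite eq_complex /=; apply/andP; split; apply/eqP; last by ring.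
have e2 : x' * x' + y' * y' = 1 - x * x - y * y - x'' * x'' - y'' * y''.
  by rewrite -h; ring.
by lra.
Qed.

Definition rows4 (r : seq (seq C)) := natmx 4 (fun i j => nth 0 (nth [::] r i) j).

Lemma Sigma_mul (g U : 'M[C]_4) : Sigma (g *m U) = g *m Sigma U *m g^T.
Proof. by rewrite /Sigma trmx_mul !mulmxA. Qed.

End sigma_coordinates.

(** * Lifting planar rotations of the six coordinates to SU(4) *)

Section lifted_rotations.
Variable R : realType.
Local Notation C := R[i].
Implicit Types U : 'M[C]_4.

(** The action of a matrix on the exterior square of C^4 by its 2 x 2 minors. Eliminating the dual
    entries lets the first row of Sigma transform by itself, linearly over the reals. *)
Lemma Sigma_rows4 (r : seq (seq C)) U i j : SU R 4 U -> (i < 4)%N -> (j < 4)%N ->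
  let f a b := nth 0 (nth [::] r a) b in
  let minor k l := f i k * f j l - f i l * f j k in
  let a := sigma_entry U 0 1 in let b := sigma_entry U 0 2 in
  let e := sigma_entry U 0 3 in
  sigma_entry (rows4 r *m U) i j =
    a * minor 0 1%N + b * minor 0 2 + e * minor 0 3
    - e^*%C * minor 1%N 2 + b^*%C * minor 1%N 3 - a^*%C * minor 2 3.
Proof.
move=> sU i4 j4 f minor a b e.
have [s23 s13 s12] := sigma_dual sU.
have sN := @sigma_entryN R U; have sii := @sigma_entryii R U.
rewrite Sigma_mul {}/a {}/b {}/e.
move: (Sigma U) s23 s13 s12 sN sii => S s23 s13 s12 sN sii.
rewrite mxE sum_ord4 !mxE !sum_ord4 !mxE !inordK//= -/(f _ _) !sii.
rewrite (sN 1%N 0%N) (sN 2 0%N) (sN 3 0%N) (sN 2 1%N) (sN 3 1%N) (sN 3 2).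
by rewrite s23 s13 s12 /minor /f; ring.
Qed.

Lemma rows4_SU (r : seq (seq C)) :
  let f a b := nth 0 (nth [::] r a) b in
  (forall i j, (i < 4)%N -> (j < 4)%N ->
     f i 0%N * (f j 0%N)^*%C + f i 1%N * (f j 1%N)^*%C +
     f i 2 * (f j 2)^*%C + f i 3 * (f j 3)^*%C = (i == j)%:R) ->
  \det (rows4 r) = 1 -> SU R 4 (rows4 r).
Proof.
move=> f fE d1; split => //; apply/unitarymxP/matrixP => i j.
by rewrite !mxE sum_ord4 !mxE !inordK//= -val_eqE /= -fE.
Qed.

Lemma sigma_coordsE U i : sigma_coords U 0 i =
  nth 0 [:: complex.Re (sigma_entry U 0 1); complex.Im (sigma_entry U 0 1);
            complex.Re (sigma_entry U 0 2); complex.Im (sigma_entry U 0 2);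
            complex.Re (sigma_entry U 0 3); complex.Im (sigma_entry U 0 3)] i.
Proof. exact: mxE. Qed.

Let quadratic (f : nat -> nat -> C) (a b e : C) (j : nat) :=
  let minor k l := f 0%N k * f j l - f 0%N l * f j k in
  a * minor 0%N 1%N + b * minor 0%N 2 + e * minor 0%N 3
    - e^*%C * minor 1%N 2 + b^*%C * minor 1%N 3 - a^*%C * minor 2 3.

Let coords6 (a b e : C) := [:: complex.Re a; complex.Im a; complex.Re b;
  complex.Im b; complex.Re e; complex.Im e].

Let lift_rotation (r : seq (seq C)) (i : nat) (c s : R) :
  (0 < i < 6)%N ->
  let f a b := nth 0 (nth [::] r a) b in
  (forall i j, (i < 4)%N -> (j < 4)%N ->
     f i 0%N * (f j 0%N)^*%C + f i 1%N * (f j 1%N)^*%C +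
     f i 2 * (f j 2)^*%C + f i 3 * (f j 3)^*%C = (i == j)%:R) ->
  \det (rows4 r) = 1 ->
  (forall a b e, let x := nth 0 (coords6 a b e) in
     coords6 (quadratic f a b e 1) (quadratic f a b e 2) (quadratic f a b e 3) =
     [seq if n == i then c * x i - s * x 0%N else
          if n == 0%N then s * x i + c * x 0%N else x n | n <- iota 0 6]) ->
  exists g, SU R 4 g /\ forall U, SU R 4 U ->
    sigma_coords (g *m U) =
    sigma_coords U *m planar_rotation (inord i) (inord 0) c s.
Proof.
move=> /andP[i0 i6] f uf df rot; exists (rows4 r).
split; first exact: rows4_SU.
move=> U sU; apply/rowP => b.
rewrite planar_rotationE !sigma_coordsE -!val_eqE /= !inordK//.
pose a0 := sigma_entry U 0 1; pose b0 := sigma_entry U 0 2.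
pose e0 := sigma_entry U 0 3.
transitivity (nth 0 (coords6 (quadratic f a0 b0 e0 1) (quadratic f a0 b0 e0 2)
  (quadratic f a0 b0 e0 3)) b).
  rewrite (Sigma_rows4 r (i := 0) (j := 1) sU)//.
  rewrite (Sigma_rows4 r (i := 0) (j := 2) sU)//.
  by rewrite (Sigma_rows4 r (i := 0) (j := 3) sU).
by rewrite rot (nth_map 0%N) ?size_iota// nth_iota.
Qed.

(** The goals are unitarity, determinant and action on the coordinates. [lra] treats monomials as
    atoms, so it is handed the square of [cs] for the quartic determinant and the multiples of [cs]
    by each coordinate for the action. *)
Ltac lift_rotation cs rows :=
  apply: (lift_rotation (r := rows)) => //;
  [ move=> [|[|[|[|?]]]]// [|[|[|[|?]]]]// _ _;
    apply/eqP; rewrite eq_complex /=; apply/andP; split; apply/eqP; lra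
  | have := congr1 (fun x => x ^+ 2) cs; rewrite /= expr1n => ?;
    rewrite /rows4 det4E /=; apply/eqP; rewrite eq_complex /=;
    apply/andP; split; apply/eqP; lra
  | move=> [x0 x1] [x2 x3] [x4 x5];
    have := (congr1 ( *%R x0) cs, congr1 ( *%R x1) cs, congr1 ( *%R x2) cs);
    have := (congr1 ( *%R x3) cs, congr1 ( *%R x4) cs, congr1 ( *%R x5) cs);
    rewrite /= !mulr1 => -[[? ?] ?] [[? ?] ?];
    congr [:: _; _; _; _; _; _]; rewrite /quadratic /=; lra ].

(* The spin double cover: conjugation by a rotation of two pairs of rows, by
   half the angle, rotates one coordinate plane of R^6. *)
Lemma sigma_rotation (c s : R) (i : 'I_6) : i != inord 0 -> c ^+ 2 + s ^+ 2 = 1 ->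
  exists g, SU R 4 g /\ forall U, SU R 4 U ->
    sigma_coords (g *m U) =
    sigma_coords U *m planar_rotation i (inord 0) (c ^+ 2 - s ^+ 2) (2 * c * s).
Proof.
move=> i0 cs; rewrite -(inord_val i) in i0 *.
have i0' : (i != 0 :> nat) by apply: contraNneq i0 => ->.
case: i i0' {i0} => [[|[|[|[|[|[|]]]]]]]//= _ _.
(* The partners of Re Sigma_01 are, in order, Im Sigma_01 and the real and imaginary parts of
   Sigma_02 and Sigma_03. The first lift is a phase on the row pairs; for Sigma_02 rows 0, 3 and 1,
   2 are mixed, for Sigma_03 rows 0, 2 and 1, 3, with imaginary sines for the imaginary parts. *)
- lift_rotation cs [:: [:: c -i* s; 0; 0; 0]; [:: 0; c -i* s; 0; 0];
    [:: 0; 0; c +i* s; 0]; [:: 0; 0; 0; c +i* s]].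
- lift_rotation cs [:: [:: c%:C; 0; 0; (- s)%:C]; [:: 0; c%:C; s%:C; 0];
    [:: 0; (- s)%:C; c%:C; 0]; [:: s%:C; 0; 0; c%:C]].
- lift_rotation cs [:: [:: c%:C; 0; 0; 0 -i* s]; [:: 0; c%:C; 0 -i* s; 0];
    [:: 0; 0 -i* s; c%:C; 0]; [:: 0 -i* s; 0; 0; c%:C]].
- lift_rotation cs [:: [:: c%:C; 0; s%:C; 0]; [:: 0; c%:C; 0; s%:C];
    [:: (- s)%:C; 0; c%:C; 0]; [:: 0; (- s)%:C; 0; c%:C]].
- lift_rotation cs [:: [:: c%:C; 0; 0 +i* s; 0]; [:: 0; c%:C; 0; 0 -i* s];
    [:: 0 +i* s; 0; c%:C; 0]; [:: 0; 0 -i* s; 0; c%:C]].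
Qed.

End lifted_rotations.

(** * The law of Sigma under Haar measure *)

Section complex_measurability.
Variable R : realType.
Local Notation C := R[i].

Lemma measurable_Re : measurable_fun [set: C] (@complex.Re R).
Proof.
move=> _ B mB; apply: sub_sigma_algebra; left.
by exists B.
Qed.

Lemma measurable_Im : measurable_fun [set: C] (@complex.Im R).
Proof.
move=> _ B mB; apply: sub_sigma_algebra; right.
by exists B.
Qed.

Context {d : measure_display} {T : measurableType d}.
Implicit Types F G : T -> C.

Definition cmeasurable F :=
  measurable_fun [set: T] (fun x => complex.Re (F x)) /\
  measurable_fun [set: T] (fun x => complex.Im (F x)).

Lemma cmeasurableP F : cmeasurable F -> measurable_fun [set: T] F.
Proof.
move=> [mF1 mF2]; apply: (measurability
  (preimage_set_system setT (@complex.Re R) measurable `|`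
   preimage_set_system setT (@complex.Im R) measurable)) => //.
move=> _ [_ [] [B mB <-] <-]; rewrite !setTI.
- by have := mF1 measurableT B mB; rewrite setTI.
- by have := mF2 measurableT B mB; rewrite setTI.
Qed.

Lemma cmeasurable_cst z : cmeasurable (fun=> z).
Proof. by split; exact: measurable_cst. Qed.

Lemma cmeasurableD F G : cmeasurable F -> cmeasurable G ->
  cmeasurable (fun x => F x + G x).
Proof.
move=> [mF1 mF2] [mG1 mG2]; split.
- rewrite (_ : (fun _ => _) = fun x => complex.Re (F x) + complex.Re (G x)).
    exact: measurable_funD.
  by apply/funext => x; case: (F x) (G x) => [? ?] [].
- rewrite (_ : (fun _ => _) = fun x => complex.Im (F x) + complex.Im (G x)).
    exact: measurable_funD.
  by apply/funext => x; case: (F x) (G x) => [? ?] [].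
Qed.

Lemma cmeasurableM F G : cmeasurable F -> cmeasurable G ->
  cmeasurable (fun x => F x * G x).
Proof.
move=> [mF1 mF2] [mG1 mG2]; split.
- rewrite (_ : (fun _ => _) = fun x => complex.Re (F x) * complex.Re (G x)
    - complex.Im (F x) * complex.Im (G x)).
    by apply: measurable_funB; exact: measurable_funM.
  by apply/funext => x; case: (F x) (G x) => [? ?] [].
- rewrite (_ : (fun _ => _) = fun x => complex.Re (F x) * complex.Im (G x)
    + complex.Im (F x) * complex.Re (G x)).
    by apply: measurable_funD; exact: measurable_funM.
  by apply/funext => x; case: (F x) (G x) => [? ?] [].
Qed.

Lemma cmeasurable_sum (J : Type) (r : seq J) (F : J -> T -> C) :
  (forall j, cmeasurable (F j)) -> cmeasurable (fun x => \sum_(j <- r) F j x).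
Proof.
move=> mF; elim: r => [|j r IH].
  by under [X in cmeasurable X]eq_fun do rewrite big_nil; exact: cmeasurable_cst.
under [X in cmeasurable X]eq_fun do rewrite big_cons.
exact: cmeasurableD.
Qed.

Lemma cmeasurable_prod (J : Type) (r : seq J) (F : J -> T -> C) :
  (forall j, cmeasurable (F j)) -> cmeasurable (fun x => \prod_(j <- r) F j x).
Proof.
move=> mF; elim: r => [|j r IH].
  by under [X in cmeasurable X]eq_fun do rewrite big_nil; exact: cmeasurable_cst.
under [X in cmeasurable X]eq_fun do rewrite big_cons.
exact: cmeasurableM.
Qed.

Lemma cmeasurable_conj F : cmeasurable F -> cmeasurable (fun x => (F x)^*%C).
Proof.
move=> [mF1 mF2]; split.
- rewrite (_ : (fun _ => _) = fun x => complex.Re (F x))//.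
  by apply/funext => x; case: (F x).
- rewrite (_ : (fun _ => _) = fun x => -1 * complex.Im (F x)).
    by apply: measurable_funM => //; exact: measurable_cst.
  by apply/funext => x; case: (F x) => a b; rewrite mulN1r.
Qed.

Lemma cmeasurable_eq F z : cmeasurable F -> measurable [set x | F x = z].
Proof.
move=> [mF1 mF2].
have -> : [set x | F x = z] =
    (fun x => complex.Re (F x)) @^-1` [set complex.Re z] `&`
    (fun x => complex.Im (F x)) @^-1` [set complex.Im z].
  apply/seteqP; split => x /=; first by move=> ->.
  by case: (F x) z => [a b] [a' b'] /= [-> ->].
by apply: measurableI; rewrite -[X in measurable X]setTI;
  [apply: mF1|apply: mF2].
Qed.

End complex_measurability.

Section law_of_Sigma.
Variable R : realType.
Local Notation C := R[i].

Lemma cmeasurable_entry n (i j : 'I_n) :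
  cmeasurable (fun U : 'M[C]_n => U i j).
Proof.
split; apply: measurableT_comp; try exact: measurable_mxentry.
- exact: measurable_Re.
- exact: measurable_Im.
Qed.

Lemma measurable_SU n : measurable (SU R n).
Proof.
have -> : SU R n =
    (\bigcap_(ij in [set: 'I_n * 'I_n])
       [set U : 'M[C]_n | (U *m U^t*) ij.1 ij.2 = (ij.1 == ij.2)%:R])
    `&` [set U | \det U = 1].
  apply/seteqP; split => U /= [uU dU]; split => //.
    by move=> [i j] _ /=; move/unitarymxP : uU => ->; rewrite mxE.
  by apply/unitarymxP/matrixP => i j; rewrite (uU (i, j) I) [RHS]mxE.
apply: measurableI.
  apply: fin_bigcap_measurable => // -[i j] _ /=.
  apply: cmeasurable_eq; under [X in cmeasurable X]eq_fun do rewrite mxE.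
  apply: cmeasurable_sum => k; apply: cmeasurableM; first exact: cmeasurable_entry.
  under [X in cmeasurable X]eq_fun do rewrite !mxE.
  exact/cmeasurable_conj/cmeasurable_entry.
apply: cmeasurable_eq; apply: cmeasurable_sum => s.
apply: cmeasurableM; first exact: cmeasurable_cst.
by apply: cmeasurable_prod => i; exact: cmeasurable_entry.
Qed.

Lemma measurable_sigma_coords : measurable_fun [set: 'M[C]_4] (@sigma_coords R).
Proof.
have mS i j : cmeasurable (fun U : 'M[C]_4 => Sigma U i j).
  under [X in cmeasurable X]eq_fun do rewrite mxE.
  apply: cmeasurable_sum => k; apply: cmeasurableM; last first.
    by under [X in cmeasurable X]eq_fun do rewrite mxE; exact: cmeasurable_entry.
  under [X in cmeasurable X]eq_fun do rewrite mxE.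
  apply: cmeasurable_sum => l; apply: cmeasurableM; first exact: cmeasurable_entry.
  exact: cmeasurable_cst.
apply: measurable_fun_mx => i j; rewrite (ord1 i).
under [X in measurable_fun _ X]eq_fun do rewrite sigma_coordsE.
by case: j => [[|[|[|[|[|[|]]]]]]]//= _;
  [have [] := mS (inord 0) (inord 1)|have [] := mS (inord 0) (inord 1)
  |have [] := mS (inord 0) (inord 2)|have [] := mS (inord 0) (inord 2)
  |have [] := mS (inord 0) (inord 3)|have [] := mS (inord 0) (inord 3)].
Qed.

Variable haar : probability 'M[C]_4 R.
Hypothesis haarP : normalized_haar_SU haar.

Definition sigma_law : {measure set 'rV[R]_6 -> \bar R} :=
  measure_function_pushforward__canonical__measure_function_Measure
    haar measurable_sigma_coords.

Lemma sigma_lawE A : sigma_law A = haar (@sigma_coords R @^-1` A).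
Proof. by []. Qed.

Let mSU : measurable (SU R 4). Proof. exact: measurable_SU. Qed.
Let mcoords A : measurable A -> measurable (@sigma_coords R @^-1` A).
Proof. by move=> mA; rewrite -[X in measurable X]setTI; exact: measurable_sigma_coords. Qed.

Let haar_setC : haar (~` SU R 4) = 0%E.
Proof. by rewrite probability_setC// (haarP.1) subee. Qed.

(** The identities for [sigma_coords] hold on the group only, so preimages agree only after
    intersection with it; its complement has Haar measure 0. *)
Let haar_eq_SU A B : measurable A -> measurable B ->
  A `&` SU R 4 = B `&` SU R 4 -> haar A = haar B.
Proof.
move=> mA mB AB; have null X : measurable X -> haar (X `\` SU R 4) = 0%E.
  move=> mX; have mC : measurable (~` SU R 4) by exact: measurableC.
  have mD : measurable (X `\` SU R 4) by exact: measurableD.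
  by apply: (subset_measure0 mD mC) => // x [].
have restrict X : measurable X -> haar X = haar (X `&` SU R 4).
  move=> mX; transitivity (haar (X `\` SU R 4) + haar (X `&` SU R 4))%E.
    exact: measureDI.
  by rewrite null// add0e.
by rewrite (restrict A)// (restrict B)// AB.
Qed.

Let sphere_preimage : SU R 4 `<=` @sigma_coords R @^-1` unit_sphere R 6.
Proof. by move=> U /sigma_coords_sphere. Qed.

Lemma sigma_law_sphere : sigma_law (unit_sphere R 6) = 1%E.
Proof.
rewrite sigma_lawE -(haarP.1); apply: haar_eq_SU => //.
  by apply: mcoords; exact: unit_sphere_measurable.
by rewrite setIid; apply/setIidPr.
Qed.

Lemma sigma_law_invariant (i : 'I_6) : i != inord 0 ->
  planar_invariant i (inord 0) sigma_law.
Proof.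
move=> i0 c s cs A mA; rewrite !sigma_lawE.
have [g [gSU gE]] := sigma_rotation i0 cs.
rewrite -[RHS](haarP.2 g gSU _ (mcoords mA)).
have mg : measurable_fun [set: 'M[C]_4] (fun U : 'M[C]_4 => g *m U).
  apply: measurable_fun_mx => k l; apply: cmeasurableP.
  under [X in cmeasurable X]eq_fun do rewrite mxE.
  apply: cmeasurable_sum => o; apply: cmeasurableM; last exact: cmeasurable_entry.
  exact: cmeasurable_cst.
apply: haar_eq_SU.
- have := mulmxr_measurable (planar_rotation i (inord 0) (c ^+ 2 - s ^+ 2) (2 * c * s)).
  by move=> /(_ measurableT _ mA); rewrite setTI => /mcoords.
- by rewrite -[X in measurable X]setTI; apply: mg => //; exact: mcoords.
- by apply/seteqP; split => U /= [AU sU]; split => //;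
    move: AU; rewrite /preimage /= gE.
Qed.

Lemma Rintegral_SU (f : 'rV[R]_6 -> R) : bounded_measurable (unit_sphere R 6) f ->
  \int[haar]_(U in SU R 4) f (sigma_coords U) =
  \int[sigma_law]_(x in unit_sphere R 6) f x.
Proof.
move=> bf; have [mf [K fK]] := bf.
have mS6 : measurable (unit_sphere R 6) by exact: unit_sphere_measurable.
have bfc : haar.-integrable (@sigma_coords R @^-1` unit_sphere R 6)
    (EFin \o (f \o @sigma_coords R)).
  apply: bounded_measurable_integrable.
  - exact: mcoords.
  - by rewrite (le_lt_trans (probability_le1 _ _)) ?ltry//; exact: mcoords.
  - split; first by apply: measurableT_comp => //; exact: measurable_sigma_coords.
    by exists K => U; exact: fK.
congr fine; rewrite (integral_pushforward measurable_sigma_coords)//; last first.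
  exact/measurable_EFinP.
(* The preimage of the sphere contains SU(4) and may be larger; the excess is a null set. *)
rewrite (negligible_integral _ _ bfc haar_setC); last 2 first.
- exact: measurableC.
- exact: mcoords.
congr (integral _ _ _); rewrite setDE setCK.
by apply/esym/setIidPr.
Qed.

End law_of_Sigma.

(** * Expansion of the partition function *)

Section sphere_generating_function.
Variable R : realType.
Variables (s : {measure set 'rV[R]_6 -> \bar R}) (i4 i2 : 'I_6) (z kappa : R).
Hypothesis i24 : i2 != i4.
Hypothesis s1 : s (unit_sphere R 6) = 1%E.
Hypothesis inv : forall i, i != i4 -> planar_invariant i i4 s.
Hypotheses (z0 : 0 <= z) (kappa0 : 0 <= kappa).

Local Notation p x := (x 0 i2 ^+ 2 + x 0 i4 ^+ 2).
Let mS6 : measurable (unit_sphere R 6). Proof. exact: unit_sphere_measurable. Qed.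
Let sfin : (s (unit_sphere R 6) < +oo)%E. Proof. by rewrite s1 ltry. Qed.
Let integrable f : bounded_measurable (unit_sphere R 6) f ->
  s.-integrable (unit_sphere R 6) (EFin \o f).
Proof. exact: (bounded_measurable_integrable mS6 sfin). Qed.

Let Rintegral_sphere_le f K : bounded_measurable (unit_sphere R 6) f ->
  (forall x, unit_sphere R 6 x -> `|f x| <= K) ->
  `|\int[s]_(x in unit_sphere R 6) f x| <= K.
Proof.
by move=> bf /(Rintegral_normr_le mS6 sfin bf); rewrite s1 mulr1.
Qed.

(** The SU(4) integral of Z^eff as a function of [y = j cos (theta / 2)]; the term [- z / 2] comes
    from the [- 4] in [trace_SigmaB]. *)
Definition generating y :=
  \int[s]_(x in unit_sphere R 6) expR (z * p x - z / 2 + kappa * y * x 0 i4).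

Definition half_moment k := expR (- (z / 2)) * exp_moment s i4 i2 z k.

Lemma sphere_p_le1 x : unit_sphere R 6 x -> p x <= 1.
Proof.
rewrite /unit_sphere /= (bigD1 i4)//= (bigD1 i2)//= => <-.
rewrite addrA [X in X <= _]addrC lerDl.
by apply: sumr_ge0 => i _; exact: sqr_ge0.
Qed.

Let coord_le1 x : unit_sphere R 6 x -> `|x 0 i4| <= 1.
Proof.
move=> /sphere_p_le1 p1.
rewrite -(ler_pXn2r (ltn0Sn 1)) ?nnegrE// expr1n real_normK ?num_real//.
by apply: le_trans p1; rewrite lerDr sqr_ge0.
Qed.

Let weight_le x : unit_sphere R 6 x -> expR (z * p x - z / 2) <= expR (z / 2).
Proof.
move=> /sphere_p_le1 p1; rewrite ler_expR.
have : z * p x <= z by rewrite ler_piMr.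
by lra.
Qed.

Lemma generating_expansion N y t Y : 0 <= t <= 1 -> 0 <= Y -> `|y| <= t * Y ->
  `|generating y - \sum_(0 <= k < N) (kappa * y) ^+ k / k`!%:R * half_moment k| <=
  expR (z / 2) * (t ^+ N * (expR (kappa * Y) - exp_sum N (kappa * Y))).
Proof.
move=> t01 Y0 ytY.
pose h k (x : 'rV[R]_6) :=
  (kappa * y) ^+ k / k`!%:R * expR (- (z / 2)) * (expR (z * p x) * x 0 i4 ^+ k).
have bh k : bounded_measurable (unit_sphere R 6) (h k).
  by rewrite /h; bounded_measurable.
have -> : \sum_(0 <= k < N) (kappa * y) ^+ k / k`!%:R * half_moment k =
    \int[s]_(x in unit_sphere R 6) (\sum_(0 <= k < N) h k x).
  rewrite (Rintegral_sum mS6 sfin)//; apply: eq_bigr => k _.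
  rewrite /half_moment mulrA -RintegralZl//.
  by apply: integrable; bounded_measurable.
have bs := bounded_measurable_sum N bh.
have bg : bounded_measurable (unit_sphere R 6)
   (fun x => expR (z * p x - z / 2 + kappa * y * x 0 i4)) by bounded_measurable.
rewrite /generating -RintegralB//; [|exact: integrable..].
apply: Rintegral_sphere_le; first exact: bounded_measurableB.
move=> x Sx; have x1 := coord_le1 Sx.
have -> : \sum_(0 <= k < N) h k x =
    expR (z * p x - z / 2) * exp_sum N (kappa * y * x 0 i4).
  rewrite mulr_sumr; apply: eq_bigr => k _.
  by rewrite /h expRD [(_ * x 0 i4) ^+ k]exprMn; ring.
rewrite expRD -mulrBr normrM ger0_norm ?expR_ge0//.
rewrite ler_pM ?expR_ge0// ?weight_le//.
apply: expR_remainder => //; first exact: mulr_ge0.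
rewrite !normrM (ger0_norm kappa0) mulrCA -mulrA ler_wpM2l// -[leRHS]mulr1.
by rewrite ler_pM.
Qed.

(** A pointwise limit of polynomials in [y], by the expansion with [t = 1]; no joint measurability
    is involved. *)
Lemma measurable_generating : measurable_fun [set: R] generating.
Proof.
apply: (@measurable_fun_cvg _ _ _ setT
  (fun N y => \sum_(0 <= k < N) (kappa * y) ^+ k / k`!%:R * half_moment k)).
  move=> N; apply: measurable_sum => k; apply: measurable_funM; last exact: measurable_cst.
  apply: measurable_funM; last exact: measurable_cst.
  by apply: measurable_funX; apply: measurable_funM => //; exact: measurable_cst.
move=> y _; apply/cvgrPdist_le => e e0.
have cv : (fun N => expR (z / 2) * (expR (kappa * `|y|) - exp_sum N (kappa * `|y|)))
    @ \oo --> expR (z / 2) * (expR (kappa * `|y|) - expR (kappa * `|y|)).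
  apply: cvgM; first exact: cvg_cst.
  by apply: cvgB; [exact: cvg_cst|exact: exp_sum_cvg].
rewrite subrr mulr0 in cv; move/cvgrPdist_le : cv => /(_ _ e0) [M _ HM].
exists M => // N /= /HM; rewrite sub0r normrN => h.
have one : 0 <= (1 : R) <= 1 by rewrite ler01 lexx.
apply: le_trans (generating_expansion N one (normr_ge0 y) _) _.
  by rewrite mul1r.
by rewrite expr1n mul1r; apply: le_trans h; exact: ler_norm.
Qed.

Lemma generating_le y : `|generating y| <= expR (z / 2 + kappa * `|y|).
Proof.
apply: Rintegral_sphere_le; first by bounded_measurable.
move=> x Sx; rewrite ger0_norm ?expR_ge0// ler_expR.
apply: lerD; first by have := weight_le Sx; rewrite ler_expR.
apply: le_trans (ler_norm _) _; rewrite !normrM (ger0_norm kappa0).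
rewrite -[leRHS]mulr1 ler_pM ?mulr_ge0//; exact: coord_le1.
Qed.

Lemma half_moment_odd k : odd k -> half_moment k = 0.
Proof. by move=> ok; rewrite /half_moment exp_moment_odd// mulr0. Qed.

Local Notation circle := (`[0, 2 * pi]%classic : set (measurableTypeR R)).

Lemma bounded_measurable_generating j :
  bounded_measurable circle (fun theta => generating (j * half_cos theta)).
Proof.
have [mh _] := bounded_measurable_half_cos R.
split.
  apply: (measurableT_comp measurable_generating).
  by apply: measurable_funM => //; exact: measurable_cst.
exists (expR (z / 2 + kappa * `|j|)) => theta _.
apply: le_trans (generating_le _) _; rewrite ler_expR lerD2l ler_wpM2l//.
by rewrite normrM ler_piMr// /half_cos cos_max.
Qed.

Lemma circle_expansion N (w : R -> R) j : bounded_measurable circle w ->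
  (forall theta, `|w theta| <= 1) -> `|j| <= 1 ->
  `|\int[lebesgue_measure]_(theta in `[0, 2 * pi])
       (w theta * generating (j * half_cos theta)) -
    \sum_(0 <= k < N) (kappa * j) ^+ k / k`!%:R * half_moment k *
       \int[lebesgue_measure]_(theta in `[0, 2 * pi])
         (w theta * half_cos theta ^+ k)| <=
  expR (z / 2) * (`|j| ^+ N * expR kappa) * (2 * pi).
Proof.
move=> bw w1 j1.
have int := @circle_integrable R.
have bhc := bounded_measurable_half_cos R.
have bg := bounded_measurable_generating j.
pose h k (theta : measurableTypeR R) :=
  (kappa * j) ^+ k / k`!%:R * half_moment k * (w theta * half_cos theta ^+ k).
have bh k : bounded_measurable circle (h k).
  by apply: bounded_measurableM; [exact: bounded_measurable_cst|];
     apply: bounded_measurableM => //; exact: bounded_measurableX.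
have -> : \sum_(0 <= k < N) (kappa * j) ^+ k / k`!%:R * half_moment k *
       \int[lebesgue_measure]_(theta in `[0, 2 * pi])
         (w theta * half_cos theta ^+ k) =
    \int[lebesgue_measure]_(theta in `[0, 2 * pi]) (\sum_(0 <= k < N) h k theta).
  rewrite (Rintegral_sum (@measurable_circle R) (@circle_finite R))//.
  apply: eq_bigr => k _; rewrite -RintegralZl//.
  by apply: int; apply: bounded_measurableM => //; exact: bounded_measurableX.
have bs := bounded_measurable_sum N bh.
rewrite -RintegralB//; last 2 first.
- by apply: int; exact: bounded_measurableM.
- exact: int.
have massE : fine (@lebesgue_measure R circle) = 2 * pi.
  exact: (congr1 fine (@circle_measure R)).
rewrite -[in leRHS]massE.
apply: (Rintegral_normr_le (@measurable_circle R) (@circle_finite R)).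
  by apply: bounded_measurableB => //; exact: bounded_measurableM.
move=> theta _.
have -> : \sum_(0 <= k < N) h k theta = w theta *
   \sum_(0 <= k < N) (kappa * (j * half_cos theta)) ^+ k / k`!%:R * half_moment k.
  rewrite mulr_sumr; apply: eq_bigr => k _; rewrite /h !exprMn; ring.
rewrite -mulrBr normrM -[leRHS]mul1r ler_pM//.
have j01 : 0 <= `|j| <= 1 by rewrite normr_ge0.
apply: le_trans (generating_expansion N j01 ler01 _) _.
  by rewrite normrM ler_wpM2l// /half_cos cos_max.
rewrite mulr1 ler_wpM2l ?expR_ge0// ler_wpM2l ?exprn_ge0// gerBl.
by apply: sumr_ge0 => k _; rewrite divr_ge0 ?exprn_ge0.
Qed.

Lemma sum_even_odd (F : nat -> R) n : (forall k, odd k -> F k = 0) ->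
  \sum_(0 <= k < 2 * n) F k = \sum_(0 <= m < n) F (2 * m)%N.
Proof.
move=> F0; elim: n => [|n IH]; first by rewrite !big_geq.
rewrite mulnS add2n !big_nat_recr//= IH [F (2 * n).+1]F0 ?addr0//.
by rewrite mul2n /= odd_double.
Qed.

(** The factor [1 / 4^nu] is [cos_coef nu nu / (2 pi)]; likewise [(2 nu + 2) / 4^(nu + 1)] in
    [subleading_coef] is [cos_coef nu.+1 nu / (2 pi)]. *)
Definition leading_coef nu :=
  kappa ^+ (2 * nu) / (2 * nu)`!%:R * half_moment (2 * nu) / 4 ^+ nu.

Definition subleading_coef nu :=
  kappa ^+ (2 * nu.+1) / (2 * nu.+1)`!%:R * half_moment (2 * nu.+1) *
  (2 * nu + 2)%:R / 4 ^+ nu.+1.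

(** Odd moments vanish and [cos (nu theta)] is orthogonal to [half_cos ^ (2 m)] for [m < nu], so
    cutting the series at [k = 2 nu + 4] leaves just [m = nu] and [m = nu + 1]. *)
Lemma cos_expansion nu j : `|j| <= 1 ->
  `|(2 * pi)^-1 * \int[lebesgue_measure]_(theta in `[0, 2 * pi])
       (cos (nu%:R * theta) * generating (j * half_cos theta)) -
    (leading_coef nu * j ^+ (2 * nu) + subleading_coef nu * j ^+ (2 * nu.+1))| <=
  expR (z / 2) * expR kappa * `|j| ^+ (2 * nu.+2).
Proof.
move=> j1; have pi2 : 0 < 2 * pi :> R by rewrite mulr_gt0 ?pi_gt0.
have := circle_expansion (2 * nu.+2) (bounded_measurable_cos nu%:R)
  (fun theta => cos_max _) j1.
rewrite sum_even_odd => [|k ok]; last by rewrite half_moment_odd// mulr0 mul0r.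
rewrite big_nat_recr//= big_nat_recr//= big_nat_cond big1 => [|m /andP[/andP[_ mn] _]].
  rewrite add0r -!/(cos_coef _ _ _) cos_coef_diag cos_coef_subdiag.
  set I := Rintegral _ _ _; set K := expR (z / 2); set L := expR kappa => h.
  rewrite -(ler_pM2l pi2) -{1}(gtr0_norm pi2) -normrM.
  apply: le_trans (_ : K * (`|j| ^+ (2 * nu.+2) * L) * (2 * pi) <= _).
    apply: le_trans h; rewrite le_eqVlt; apply/orP; left; apply/eqP.
    congr (`|_|); rewrite /leading_coef /subleading_coef !exprMn.
    clearbody I; move: (@pi R) (pi_gt0 R) => q q0; field.
    by rewrite (gt_eqF q0) !expf_neq0 ?pnatr_eq0// -!lt0n !fact_gt0.
  by rewrite le_eqVlt; apply/orP; left; apply/eqP; ring.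
by rewrite -/(cos_coef _ _ _) cos_coef_eq0// mulr0.
Qed.

(** This is the imaginary part of Z^eff up to sign. The constant [c] is complex, so that part enters
    the real part of the hypothesis; a bound of the order of the remainder is enough. *)
Lemma sin_expansion nu j : `|j| <= 1 ->
  `|(2 * pi)^-1 * \int[lebesgue_measure]_(theta in `[0, 2 * pi])
       (sin (nu%:R * theta) * generating (j * half_cos theta))| <=
  expR (z / 2) * expR kappa * `|j| ^+ (2 * nu.+2).
Proof.
move=> j1; have pi2 : 0 < 2 * pi :> R by rewrite mulr_gt0 ?pi_gt0.
have := circle_expansion (2 * nu.+2) (bounded_measurable_sin nu%:R)
  (fun theta => sin_max _) j1.
rewrite sum_even_odd => [|k ok]; last by rewrite half_moment_odd// mulr0 mul0r.
rewrite big1 => [|m _]; last by rewrite -/(sin_coef _ _ _) sin_coef_eq0 mulr0.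
rewrite subr0; set I := Rintegral _ _ _ => h.
rewrite -(ler_pM2l pi2) -{1}(gtr0_norm pi2) -normrM mulrA divff ?gt_eqF// mul1r.
by apply: le_trans h _; rewrite le_eqVlt; apply/orP; left; apply/eqP; ring.
Qed.

End sphere_generating_function.

(** * Planar rotations as elements of SO(n) *)

Section planar_rotation_group.
Variables (R : realType) (n : nat) (i j : 'I_n).
Hypothesis ij : i != j.
Let ji : j != i. Proof. by rewrite eq_sym. Qed.

Lemma planar_rotationM (c s c' s' : R) :
  planar_rotation i j c s *m planar_rotation i j c' s' =
  planar_rotation i j (c * c' - s * s') (c * s' + s * c').
Proof.
apply/row_matrixP => k; rewrite row_mul !rowE; apply/rowP => b.
set x := delta_mx 0 k *m planar_rotation i j c s.
rewrite planar_rotationE [RHS]planar_rotationE.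
have xi : x 0 i = c * (delta_mx 0 k : 'rV[R]_n) 0 i - s * (delta_mx 0 k : 'rV[R]_n) 0 j.
  by rewrite planar_rotationE eqxx.
have xj : x 0 j = s * (delta_mx 0 k : 'rV[R]_n) 0 i + c * (delta_mx 0 k : 'rV[R]_n) 0 j.
  by rewrite planar_rotationE eqxx (negPf ji).
rewrite xi xj; case: ifP => [_|bi]; first by ring.
by case: ifP => [_|bj]; [ring|rewrite planar_rotationE bi bj].
Qed.

Lemma planar_rotation1 : planar_rotation i j (1 : R) 0 = 1%:M.
Proof.
apply/row_matrixP => k; rewrite !rowE mulmx1; apply/rowP => b.
rewrite planar_rotationE !mul1r !mul0r subr0 add0r.
by case: ifP => [/eqP ->//|_]; case: ifP => [/eqP ->|].
Qed.

Lemma planar_rotation_tr (c s : R) :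
  (planar_rotation i j c s)^T = planar_rotation i j c (- s).
Proof.
apply/matrixP => a b; rewrite !mxE.
have [->|ai] := eqVneq a i; have [->|bi] := eqVneq b i;
  rewrite ?eqxx ?(negPf ji) ?(negPf ij) /=.
- ring.
- by case: (b == j); rewrite /=; ring.
- by rewrite [i == a]eq_sym (negPf ai); case: (a == j); rewrite /=; ring.
- have [->|aj] := eqVneq a j.
    by rewrite [j == b]eq_sym; case: (b == j); rewrite /=; ring.
  have [->|bj] := eqVneq b j; last by rewrite eq_sym.
  by rewrite [j == a]eq_sym (negPf aj) /=; ring.
Qed.

Lemma planar_rotation_orthogonal (c s : R) : c ^+ 2 + s ^+ 2 = 1 ->
  planar_rotation i j c s *m (planar_rotation i j c s)^T = 1%:M.
Proof.
move=> cs; rewrite planar_rotation_tr planar_rotationM -planar_rotation1.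
by congr planar_rotation; rewrite -?cs; ring.
Qed.

Lemma planar_rotation_det (c s : R) : c ^+ 2 + s ^+ 2 = 1 ->
  \det (planar_rotation i j (c ^+ 2 - s ^+ 2) (2 * c * s)) = 1.
Proof.
move=> cs; have -> : planar_rotation i j (c ^+ 2 - s ^+ 2) (2 * c * s) =
    planar_rotation i j c s *m planar_rotation i j c s.
  by rewrite planar_rotationM; congr planar_rotation; ring.
rewrite det_mulmx -{2}det_tr -det_mulmx planar_rotation_orthogonal//.
exact: det1.
Qed.

Lemma sphere_measure_planar_invariant
    (s : {finite_measure set 'rV[R]_n -> \bar R}) :
  sphere_measure s -> planar_invariant i j s.
Proof.
move=> [_ _ inv] c t ct A mA; apply: inv => //.
- exact/planar_rotation_orthogonal/double_angle.
- exact: planar_rotation_det.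
Qed.

End planar_rotation_group.

(** * The partition function as an integral over the angle and the sphere *)

Section partition_function.
Variable R : realType.
Variable haar : probability 'M[R[i]]_4 R.
Hypothesis haarP : normalized_haar_SU haar.
Variables (V4 Phi F mu : R).
Let z := 8 * mu ^+ 2 * F ^+ 2 * V4.
Let kappa := 4 * V4 * Phi.
Let G := generating (sigma_law haar) (inord 0) (inord 1) z kappa.

Lemma cexp_real (r : R) : cexp r%:C = (expR r)%:C.
Proof.
rewrite /cexp /= cos0 sin0; apply/eqP; rewrite eq_complex /=.
by apply/andP; split; apply/eqP; ring.
Qed.

Lemma cexp_imaginary (r : R) : cexp (- 'i * r%:C) = cos r -i* sin r.
Proof.
have -> : - 'i * r%:C = 0 -i* r :> R[i].
  change ('i : R[i]) with (0 +i* 1 : R[i]).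
  by apply/eqP; rewrite eq_complex /=; apply/andP; split; apply/eqP; ring.
rewrite /cexp /= expR0 cosN sinN; apply/eqP; rewrite eq_complex /=.
by apply/andP; split; apply/eqP; ring.
Qed.

Lemma cintegral_SU (theta j : R) :
  cintegral haar (SU R 4) (fun U =>
    cexp ((mu ^+ 2 * F ^+ 2 * V4)%:C *
            \tr (Sigma U *m Bmx R *m (Sigma U)^t* *m Bmx R) +
          (j * V4 * Phi *
            complex.Re (\tr (cexp (- 'i * (theta / 2)%:C) *:
                               (Sigma_d R *m Sigma U))))%:C)) =
  (G (j * half_cos theta))%:C.
Proof.
have cexpE U : SU R 4 U ->
    cexp ((mu ^+ 2 * F ^+ 2 * V4)%:C *
            \tr (Sigma U *m Bmx R *m (Sigma U)^t* *m Bmx R) +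
          (j * V4 * Phi *
            complex.Re (\tr (cexp (- 'i * (theta / 2)%:C) *:
                               (Sigma_d R *m Sigma U))))%:C) =
    (expR (z * (sigma_coords U 0 (inord 1) ^+ 2 + sigma_coords U 0 (inord 0) ^+ 2)
       - z / 2 + kappa * (j * half_cos theta) * sigma_coords U 0 (inord 0)))%:C.
  move=> sU; rewrite trace_SigmaB// mxtraceZ trace_Sigma_d// cexp_imaginary.
  rewrite -rmorphM -rmorphD cexp_real /half_cos [2^-1 * theta]mulrC.
  by congr (expR _)%:C; rewrite /z /kappa /=; field.
rewrite /cintegral; congr (_ +i* _).
- rewrite /G /generating -Rintegral_SU//; last by bounded_measurable.
  by apply: eq_Rintegral => U; rewrite inE => /cexpE ->.
- rewrite -[RHS](mul0r (fine (haar (SU R 4)))) -Rintegral_cst; last exact: measurable_SU.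
  by apply: eq_Rintegral => U; rewrite inE => /cexpE ->.
Qed.

Lemma ZeffE nu j : 0 <= V4 -> 0 <= Phi -> Zeff haar V4 Phi F mu nu j =
  ((2 * pi)^-1 * \int[lebesgue_measure]_(theta in `[0, 2 * pi])
       (cos (nu%:R * theta) * G (j * half_cos theta))) -i*
  ((2 * pi)^-1 * \int[lebesgue_measure]_(theta in `[0, 2 * pi])
       (sin (nu%:R * theta) * G (j * half_cos theta))).
Proof.
move=> V0 Phi0.
have bg : bounded_measurable (`[0, 2 * pi]%classic : set (measurableTypeR R))
    (fun theta => G (j * half_cos theta)).
  apply: bounded_measurable_generating.
  - by rewrite -(inj_eq val_inj) /= !inordK.
  - exact: sigma_law_sphere.
  - exact: mulr_ge0 (mulr_ge0 (mulr_ge0 (ler0n _ 8) (sqr_ge0 _)) (sqr_ge0 _)) V0.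
  - by rewrite /kappa !mulr_ge0.
have phase (theta : R) : (2 * pi)^-1%:C * cexp (- 'i * nu%:R * theta%:C) =
    ((2 * pi)^-1 * cos (nu%:R * theta)) -i* ((2 * pi)^-1 * sin (nu%:R * theta)) :> R[i].
  have -> : - 'i * nu%:R * theta%:C = - 'i * (nu%:R * theta)%:C :> R[i].
    by rewrite -mulrA rmorphM rmorph_nat.
  rewrite cexp_imaginary; apply/eqP; rewrite eq_complex /=.
  by apply/andP; split; apply/eqP; ring.
have scale (w : R -> R) :
    bounded_measurable (`[0, 2 * pi]%classic : set (measurableTypeR R)) w ->
    (2 * pi)^-1 * \int[lebesgue_measure]_(theta in `[0, 2 * pi])
       (w theta * G (j * half_cos theta)) =
    \int[lebesgue_measure]_(theta in `[0, 2 * pi])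
       ((2 * pi)^-1 * (w theta * G (j * half_cos theta))).
  move=> bw; rewrite RintegralZl//; apply: circle_integrable.
  exact: bounded_measurableM.
rewrite (scale _ (bounded_measurable_cos _)).
rewrite /Zeff {1}/cintegral; congr (_ +i* _).
  by apply: eq_Rintegral => theta _; rewrite phase cintegral_SU /=; ring.
rewrite -mulrN -mulN1r -RintegralZl//; last first.
  apply: circle_integrable; apply: bounded_measurableM => //.
  exact: bounded_measurable_sin.
rewrite -RintegralZl//; last first.
  apply: circle_integrable; apply: bounded_measurableM.
    exact: bounded_measurable_cst.
  by apply: bounded_measurableM => //; exact: bounded_measurable_sin.
by apply: eq_Rintegral => theta _; rewrite phase cintegral_SU /=; ring.
Qed.

End partition_function.

(** * Comparison of the two expansions *)

Lemma measurable_inv_sqr (d : measure_display) (T : measurableType d)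
    (R : realType) (f : T -> R) : measurable_fun [set: T] f ->
  (forall w, 0 < f w) -> measurable_fun [set: T] (fun w => 1 / f w ^+ 2).
Proof.
move=> mf f0.
(* Positivity allows the inverse to be written with [expR] and [ln], both measurable. *)
have -> : (fun w => 1 / f w ^+ 2) = (fun w => expR (-1 * ln (f w)) ^+ 2).
  apply/funext => w; rewrite mulN1r expRN lnK ?posrE// div1r -exprVn//.
apply: measurable_funX; apply: measurableT_comp; first exact: measurable_expR.
by apply: measurable_funM; [exact: measurable_cst|exact: measurableT_comp].
Qed.

Unset Implicit Arguments.

Theorem mainTheorem5 (R : realType)
    (haar : probability 'M[R[i]]_4 R)
    (dn : {finite_measure set 'rV[R]_6 -> \bar R})
    (d : measure_display) (Omega : measurableType d) (P : probability Omega R)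
    (V4 Phi F mu : R) (nu : nat)
    (I : pred nat) (xi : nat -> {RV P >-> R}) (c : R[i]) (i2 i4 : 'I_6) :
  normalized_haar_SU haar ->
  sphere_measure dn ->
  i2 != i4 ->
  0 < V4 -> 0 < Phi -> 0 < F -> 0 < mu ->
  (forall n, I n -> forall w, 0 < xi n w) ->
  c != 0 ->
  (forall j : R,
     (\int[P]_w eprod1p I (fun n => j ^+ 2 / xi n w ^+ 2)%R < +oo)%E /\
     (j ^+ (2 * nu) *
      fine (\int[P]_w eprod1p I (fun n => j ^+ 2 / xi n w ^+ 2)%R)%E)%:C
     = c * Zeff haar V4 Phi F mu nu j) ->
  let z := 8 * mu ^+ 2 * F ^+ 2 * V4 in
  (\int[P]_w (\sum_(0 <= n <oo | I n) ((1 / xi n w ^+ 2)%R)%:E))%E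
  = (4 * (V4 * Phi) ^+ 2 / (2 * nu + 1)%:R *
     ((\int[dn]_(x in unit_sphere R 6)
         (expR (z * (x 0 i2 ^+ 2 + x 0 i4 ^+ 2)) * x 0 i4 ^+ (2 * nu + 2))) /
      (\int[dn]_(x in unit_sphere R 6)
         (expR (z * (x 0 i2 ^+ 2 + x 0 i4 ^+ 2)) * x 0 i4 ^+ (2 * nu)))))%:E
  /\
  (nu = 0%N ->
   (\int[P]_w (\sum_(0 <= n <oo | I n) ((1 / xi n w ^+ 2)%R)%:E))%E
   = (2 * (V4 * Phi) ^+ 2 * (z / (expR z - z - 1) + 1 - 2 / z))%:E).
Proof.
move=> haarP dnP i24 V0 Phi0 F0 mu0 xi0 _ hyp z.
pose a n w := 1 / xi n w ^+ 2.
have aE (t : R) w : (fun n => t ^+ 2 / xi n w ^+ 2) = (fun n => t ^+ 2 * a n w).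
  by apply/funext => n; rewrite /a mul1r.
have ma k : I k -> measurable_fun [set: Omega] (a k).
  by move=> Ik; apply: measurable_inv_sqr => //; exact: xi0.
have a0 k w : I k -> 0 <= a k w.
  by move=> Ik; rewrite /a divr_ge0 ?sqr_ge0.
set F_ := fun t => (\int[P]_w eprod1p I (fun k => t * a k w)%R)%E.
have hypE (j : R) : (F_ (j ^+ 2)%R < +oo)%E /\
    (j ^+ (2 * nu) * fine (F_ (j ^+ 2)))%:C = c * Zeff haar V4 Phi F mu nu j.
  have := hyp j; under eq_integral do rewrite aE.
  by [].
have F1 : (F_ 1%R < +oo)%E by have [] := hypE 1; rewrite expr1n.
pose T := (\int[P]_w (\sum_(0 <= k <oo | I k) (a k w)%:E))%E.
have [Tfin bounds] : T \is a fin_num /\ forall t, 0 <= t <= 1 ->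
    1 + t * fine T <= fine (F_ t) <= 1 + t * fine T + t ^+ 2 * fine (F_ 1).
  exact: expected_eprod1p_bounds ma a0 F1.
pose law := sigma_law haar; pose kappa := 4 * V4 * Phi.
have z0 : 0 < z by rewrite /z !mulr_gt0 ?exprn_gt0.
have kappa0 : 0 < kappa by rewrite /kappa !mulr_gt0.
have i01 : inord 1 != inord 0 :> 'I_6 by rewrite -(inj_eq val_inj) /= !inordK.
have law1 := sigma_law_sphere haarP.
have inv i : i != inord 0 -> planar_invariant i (inord 0) law.
  exact: sigma_law_invariant.
pose A0 := leading_coef law (inord 0) (inord 1) z kappa nu.
pose A1 := subleading_coef law (inord 0) (inord 1) z kappa nu.
pose K := expR (z / 2) * expR kappa.
(* With [t = j^2], dividing the real part of the hypothesis by [j^(2 nu)] leaves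
   [1 + t T = Re c (A0 + t A1)] up to [O(t^2)]. *)
have [cA0 cA1] : 1 - complex.Re c * A0 = 0 /\ fine T - complex.Re c * A1 = 0.
  apply: (@normr_le_quadratic_eq0 _ _ _
    (fine (F_ 1) + (`|complex.Re c| + `|complex.Im c|) * K)) => t t0 t1.
  pose j := Num.sqrt t; have jt : j ^+ 2 = t by rewrite sqr_sqrtr// ltW.
  have j0 : 0 < j by rewrite sqrtr_gt0.
  have j1 : `|j| <= 1.
    by rewrite gtr0_norm// -(ler_pXn2r (ltn0Sn 1)) ?nnegrE ?(ltW j0)// expr1n jt.
  have [_] := hypE j; rewrite ZeffE//; [|exact: ltW..].
  have cosj := cos_expansion i01 law1 inv (ltW z0) (ltW kappa0) nu j1.
  have sinj := sin_expansion i01 law1 inv (ltW z0) (ltW kappa0) nu j1.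
  set X := (2 * pi)^-1 * _ in cosj *; set Y := (2 * pi)^-1 * _ in sinj *.
  move=> /(congr1 (@complex.Re R)) /=.
  have -> : complex.Re (c * (X -i* Y)) = complex.Re c * X + complex.Im c * Y.
    by case: (c) => ca cb /=; ring.
  rewrite jt => fE; have t01 : 0 <= t <= 1 by rewrite (ltW t0) t1.
  have /andP[lo hi] := bounds t t01.
  have jn : 0 < j ^+ (2 * nu) by rewrite exprn_gt0.
  rewrite -(ler_pM2l jn) -{1}(gtr0_norm jn) -normrM.
  have jS : j ^+ (2 * nu.+1) = j ^+ (2 * nu) * t.
    by rewrite mulnS addnC exprD jt.
  have jSS : `|j| ^+ (2 * nu.+2) = j ^+ (2 * nu) * t ^+ 2.
    by rewrite gtr0_norm// !mulnS addnA addnC exprD (exprD _ 2 2) jt -expr2.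
  rewrite jS jSS in cosj; rewrite jSS in sinj.
  (* The three errors are those of the product bounds, of the cosine expansion and of the sine
     integral; each is [j^(2 nu)] times [O(t^2)]. *)
  have -> : j ^+ (2 * nu) * (1 - complex.Re c * A0 + (fine T - complex.Re c * A1) * t) =
    - (j ^+ (2 * nu) * (fine (F_ t) - 1 - t * fine T)) +
    (complex.Re c * (X - (A0 * j ^+ (2 * nu) + A1 * (j ^+ (2 * nu) * t))) +
     complex.Im c * Y).
    have -> : j ^+ (2 * nu) * (fine (F_ t) - 1 - t * fine T) =
      j ^+ (2 * nu) * fine (F_ t) - j ^+ (2 * nu) * (1 + t * fine T) by ring.
    by rewrite fE; ring.
  apply: le_trans (ler_normD _ _) _.
  rewrite [in leRHS]mulrDl [leRHS]mulrDr; apply: lerD.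
    rewrite normrN normrM (gtr0_norm jn) ler_wpM2l ?(ltW jn)// ger0_norm; last first.
      by rewrite -addrA -opprD subr_ge0.
    by rewrite mulrC; lra.
  apply: le_trans (ler_normD _ _) _.
  rewrite [`|complex.Re c * _|]normrM [`|complex.Im c * _|]normrM.
  have -> : j ^+ (2 * nu) * ((`|complex.Re c| + `|complex.Im c|) * K * t ^+ 2) =
    `|complex.Re c| * (K * (j ^+ (2 * nu) * t ^+ 2)) +
    `|complex.Im c| * (K * (j ^+ (2 * nu) * t ^+ 2)) by ring.
  by apply: lerD; apply: ler_wpM2l.
pose E k := exp_moment law (inord 0) (inord 1) z k.
(* This equality also yields that the moment in the denominator of the sum rule is nonzero. *)
have A0n : complex.Re c * A0 = 1 by apply/eqP; rewrite eq_sym -subr_eq0 cA0.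
have A00 : A0 != 0.
  by apply/eqP => A00; move: A0n; rewrite A00 mulr0 => /eqP; rewrite eq_sym oner_eq0.
have TE : fine T = A1 / A0.
  have -> : fine T = complex.Re c * A1 by apply/eqP; rewrite -subr_eq0 cA1.
  by apply: (mulIf A00); rewrite divfK// mulrAC A0n mul1r.
have E0 : E (2 * nu)%N != 0.
  by apply: contraNneq A00 => E0; rewrite /A0 /leading_coef /half_moment -/(E _) E0 !(mulr0, mul0r).
have ratio : fine T = 4 * (V4 * Phi) ^+ 2 / (2 * nu + 1)%:R *
    (E (2 * nu + 2)%N / E (2 * nu)%N).
  rewrite TE /A1 /A0 /subleading_coef /leading_coef /half_moment -!/(E _).
  have -> : (2 * nu.+1 = (2 * nu).+2)%N by rewrite mulnS add2n.
  have -> : (2 * nu + 2 = (2 * nu).+2)%N by rewrite addn2.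
  have -> : (2 * nu + 1 = (2 * nu).+1)%N by rewrite addn1.
  rewrite !factS !natrM !exprS.
  have ez : expR (- (z / 2)) != 0 by rewrite gt_eqF ?expR_gt0.
  have f0 : ((2 * nu)`!)%:R != 0 :> R by rewrite pnatr_eq0 -lt0n fact_gt0.
  have kn : kappa ^+ (2 * nu) != 0 by rewrite expf_neq0 ?gt_eqF.
  have q4 : (4 : R) ^+ nu != 0 by rewrite expf_neq0 ?pnatr_eq0.
  rewrite /kappa in kn *.
  move: (expR _) ez ((2 * nu)`!%:R) f0 ((4 * V4 * Phi) ^+ (2 * nu)) kn (4 ^+ nu) q4 =>
    e1 h1 e2 h2 e3 h3 e4 h4.
  field.
  by rewrite E0 h1 h2 h3 h4 -natrM nat1r -natrD !pnatr_eq0.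
have fin : (law (unit_sphere R 6) < +oo)%E by rewrite law1 ltry.
have dnfin : (dn (unit_sphere R 6) < +oo)%E.
  rewrite ltey_eq; apply/orP; left; apply: fin_num_measure.
  exact: unit_sphere_measurable.
have dn0 : fine (dn (unit_sphere R 6)) != 0.
  by have [_ dnpos _] := dnP; rewrite gt_eqF// fine_gt0// dnpos.
(* The passage from coordinates 0, 1 and the law of Sigma to the given coordinates and measure; the
   mass cancels in the quotient. *)
have dnE k : exp_moment dn i4 i2 z k = E k * fine (dn (unit_sphere R 6)).
  have := exp_moment_unique k i24 i01 dnfin fin _ inv (ltW z0).
  by rewrite law1 mulr1; apply => i i4'; exact: sphere_measure_planar_invariant.
have TfinE : T = (fine T)%:E by rewrite fineK.
split.
  rewrite -/T [LHS]TfinE ratio -!/(exp_moment _ _ _ _ _) !dnE.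
  by rewrite -mulf_div divff// mulr1.
move=> nu0; rewrite -/T [LHS]TfinE ratio nu0 muln0 !add0n; congr (_%:E).
have ez : expR z - z - 1 != 0.
  have := expR_gt1Dx (lt0r_neq0 z0); move=> h.
  by rewrite gt_eqF//; lra.
rewrite /E exp_moment0 ?exp_moment2// law1 !mulr1 /=.
have zn0 : z != 0 by exact: lt0r_neq0.
move: (expR z) ez => e ez.
by field; rewrite zn0 ez.
Qed.
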